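(* Let $X$ be a Banach space, $\alpha>-1$, and $f:(0,\infty)\to X$ a differentiable function such that $\int_0^\infty e^{-t}t^\alpha\|f(t)\|^2\,dt<\infty$. Then for each $n\ge0$ the Bochner integral $c_n(f):=\int_0^\infty\ell_n^{(\alpha)}(t)f(t)\,dt$ exists in $X$, and for every $t>0$ the series $\sum_{n=0}^\infty c_n(f)L_n^{(\alpha)}(t)$ converges in $X$ to $f(t)$.
   Context: $L_n^{(\alpha)}(t)=\sum_{k=0}^n(-1)^k\binom{n+\alpha}{n-k}\frac{t^k}{k!}$ is the generalized Laguerre polynomial, and $\ell_n^{(\alpha)}(t):=\frac{n!}{\Gamma(n+\alpha+1)}t^{\alpha}e^{-t}L_n^{(\alpha)}(t)$ for $t>0$. Differentiability of $f$ at $t$ means existence of the limit $\lim_{h\to0}\frac1h(f(t+h)-f(t))$ in the norm of $X$. *)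

(* Defs.v *)
From HB Require Import structures.
From mathcomp Require Import all_boot all_order all_algebra.
From mathcomp Require Import all_classical all_reals all_analysis.
Set Implicit Arguments. Unset Strict Implicit. Unset Printing Implicit Defensive.
Import Order.TTheory GRing.Theory Num.Theory.
Import numFieldNormedType.Exports.
Local Open Scope classical_set_scope.
Local Open Scope ring_scope.

Definition gbinom (R : realType) (x : R) (m : nat) : R :=
  (\prod_(j < m) (x - j%:R)) / (m`!)%:R.

Definition laguerre (R : realType) (n : nat) (alpha t : R) : R :=
  \sum_(k < n.+1) (-1) ^+ k * gbinom (n%:R + alpha) (n - k) * t ^+ k / (k`!)%:R.

Definition Gamma (R : realType) (s : R) : R :=
  Rintegral lebesgue_measure `]0%R, +oo[ (fun t : R => t `^ (s - 1) * expR (- t)).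

Definition ell (R : realType) (n : nat) (alpha t : R) : R :=
  (n`!)%:R / Gamma (n%:R + alpha + 1) * t `^ alpha * expR (- t) * laguerre n alpha t.

Definition simple_fun d (T : measurableType d) (R : realType) (V : normedModType R)
  (s : seq (set T * V)) : T -> V :=
  fun t => \sum_(p <- s) (\1_(p.1) t : R) *: p.2.

Definition simple_int d (T : measurableType d) (R : realType) (V : normedModType R)
  (mu : {measure set T -> \bar R}) (s : seq (set T * V)) : V :=
  \sum_(p <- s) fine (mu p.1) *: p.2.

Definition bochner_integral d (T : measurableType d) (R : realType) (V : normedModType R)
  (mu : {measure set T -> \bar R}) (D : set T) (g : T -> V) (c : V) : Prop :=
  exists s : nat -> seq (set T * V),
  [/\ forall k p, p \in s k -> [/\ measurable p.1, p.1 `<=` D & (mu p.1 < +oo)%E],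
      {ae mu, forall t, D t -> simple_fun (s k) t @[k --> \oo] --> g t},
      (\int[mu]_(t in D) (`| simple_fun (s k) t - g t |)%:E)%E @[k --> \oo] --> 0%E
    & simple_int mu (s k) @[k --> \oo] --> c].

(* Main.v *)
Require Import Defs.
From HB Require Import structures.
From mathcomp Require Import all_boot all_order all_algebra.
From mathcomp Require Import all_classical all_reals all_analysis.
From mathcomp Require Import measurable_realfun.
From mathcomp Require Import ring lra zify.
Import Order.TTheory GRing.Theory Num.Theory.
Import numFieldNormedType.Exports.
Local Open Scope classical_set_scope.
Local Open Scope ring_scope.

(** Write [w_b(s) = s^b e^(-s)] and [h_n] for the squared norm of [L_n] in
    [L^2(w_b)].  The Christoffel-Darboux formula, in the form
    [(t - s) K_N(t, s) = (t L_N^(a+1)(t) L_N^(a)(s) - s L_N^(a+1)(s) L_N^(a)(t)) / h_N],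
    expresses the error of the N-th partial sum at [t] through the integrals of
    [w_b L_N^(b) g], [b = a, a + 1], where [g] is the difference quotient of [f]
    at [t].  Two estimates of size [h_n / sqrt n] conclude.
    (i) [int w_b L_n^2 / (1 + s) <= C h_n / sqrt n]: the Laguerre coefficients of
    [L_n / (1 + s)] satisfy a discrete Sobolev inequality, both ingredients of
    which are Bessel inequalities, for the parameters [b] and [b + 1].
    (ii) [L_n(t)^2 <= C h_n / sqrt n] at each [t > 0]: by the Laguerre equation the
    energy [n y^2 + s y'^2] grows at most exponentially near [t], so (i) controls
    it pointwise.
    By (i) the functionals [g |-> int w_b L_n g], divided by [sqrt (h_n / sqrt n)],
    are uniformly bounded on [L^2((1 + s) w_b)], and by (ii) and Rodrigues' formula
    they tend to 0 on step functions, hence on all continuous [g] of this space.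
    Everything vector-valued is tested against norming functionals, obtained from a
    minimal sublinear map below the norm. *)

Set Implicit Arguments.
Unset Strict Implicit.
Unset Printing Implicit Defensive.

(** * Norming functionals *)

Section norming_functional.
Context {R : realType} {X : normedModType R}.
Implicit Types (p q : X -> R) (x y : X).

(** The estimates are critical. In the error a value of [L_N] at [t] for one parameter multiplies an
    integral for the other parameter, and [h_n^(a+1) = (n + a + 1) h_n^(a)]. The product of the two
    sizes is therefore of order [h_N] and only cancels the factor [1 / h_N] of the
    Christoffel-Darboux formula. All decay comes from the approximation of [g] by step functions,
    hence from the continuity of [g], which at [t] is the differentiability of [f]. Division by
    [s - t] also gains a factor [1 + s] at infinity. This puts [g] in the weighted spaces of both
    parameters although [f] is only square integrable for [w_a]. The norming functional of the N-th
    error changes with N, so every scalar estimate has to be uniform over functionals of norm at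
    most 1. It is, because a functional acts only on the values of the fixed [g] and of its step
    approximations. *)

Definition sublinear q :=
  (forall x y, q (x + y) <= q x + q y) /\
  (forall (a : R) x, 0 < a -> q (a *: x) <= a * q x).

Lemma sublinear0 q : sublinear q -> q 0 = 0.
Proof.
move=> [_ qZ]; have := qZ 2 0 ltac:(lra); have := qZ 2^-1 0 ltac:(lra).
by rewrite !scaler0; lra.
Qed.

Lemma sublinear_ge q x : sublinear q -> - q (- x) <= q x.
Proof.
move=> sq; have := sq.1 x (- x); rewrite subrr (sublinear0 sq); lra.
Qed.

Lemma sublinearZ q (a : R) x : sublinear q -> 0 <= a -> q (a *: x) = a * q x.
Proof.
move=> sq; rewrite le_eqVlt => /predU1P[<-|a0].
  by rewrite scale0r (sublinear0 sq) mul0r.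
apply/eqP; rewrite eq_le sq.2//=.
have := sq.2 a^-1 (a *: x); rewrite invr_gt0 => /(_ a0).
by rewrite scalerA mulVf ?gt_eqF// scale1r mulrC ler_pdivlMr// mulrC.
Qed.

(** The witness is the infimum over [t >= 0] of [q (x + t y) - t q y]. Parameters of two summands
    add up, which gives subadditivity, and rescaling [t] gives homogeneity. The values [t = 0] and
    [t = 1] give the two upper bounds. *)
Lemma sublinear_lower q y : sublinear q ->
  exists q', [/\ sublinear q', forall x, q' x <= q x &
                 forall x, q' x <= q (x + y) - q y].
Proof.
move=> sq.
pose S x : set R := [set q (x + t *: y) - t * q y | t in [set t : R | 0 <= t]].
have Sn x : S x !=set0.
  by exists (q (x + 0 *: y) - 0 * q y); exists 0 => //=.
have Sb x : has_lbound (S x).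
  exists (- q (- x)) => _ [t /= t0 <-].
  have := sq.1 (x + t *: y) (- x).
  rewrite addrAC subrr add0r (sublinearZ y sq t0); lra.
have Sle x (t : R) : 0 <= t -> inf (S x) <= q (x + t *: y) - t * q y.
  by move=> t0; apply: ge_inf => //; exists t.
exists (fun x => inf (S x)); split; last 2 first.
- by move=> x; have := Sle x 0 (lexx _); rewrite scale0r addr0 mul0r subr0.
- by move=> x; have := Sle x 1 ler01; rewrite scale1r mul1r.
split=> [x z|a x a0].
- rewrite -lerBlDr; apply: lb_le_inf => // _ [t /= t0 <-].
  rewrite lerBlDr -lerBlDl; apply: lb_le_inf => // _ [u /= u0 <-].
  rewrite lerBlDl; apply: (le_trans (Sle _ (u + t) (addr_ge0 u0 t0))).
  have := sq.1 (z + u *: y) (x + t *: y).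
  rewrite addrACA -scalerDl [z + x]addrC mulrDl; lra.
- rewrite mulrC -ler_pdivrMr//; apply: lb_le_inf => // _ [t /= t0 <-].
  rewrite ler_pdivrMr//; apply: (le_trans (Sle _ (a * t) _)).
    by rewrite mulr_ge0// ltW.
  rewrite -scalerA -scalerDr (sublinearZ _ sq (ltW a0)); lra.
Qed.

(* The infimum of a chain of sublinear maps is sublinear, so Zorn's lemma gives
   a minimal one; by sublinear_lower a minimal sublinear map is superadditive. *)
Lemma sublinear_minorant p : sublinear p ->
  exists q : X -> R, [/\ forall x, q x <= p x, forall x y, q (x + y) = q x + q y
    & forall (a : R) x, q (a *: x) = a * q x].
Proof.
move=> sp.
pose T := {q : X -> R | sublinear q /\ forall x, q x <= p x}.
(* The order is reversed, so that a maximal element for Zorn's lemma is a minimal sublinear map. *)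
pose leT (q r : T) := `[< forall x, sval r x <= sval q x >].
have [||||[q [sq qp]] qmin] := @Zorn T leT.
- by move=> [q ?]; apply/asboolP.
- move=> q r s /asboolP qr /asboolP rs; apply/asboolP => x.
  exact: le_trans (rs x) (qr x).
- move=> [q Hq] [r Hr] /asboolP/= qr /asboolP/= rq; apply: eq_exist.
  by apply/funext => x; apply/eqP; rewrite eq_le qr rq.
- move=> A Atot; have [[q0 Aq0]|A0] := pselect (A !=set0); last first.
    exists (exist _ p (conj sp (fun x => lexx _))) => s As.
    by exfalso; apply: A0; exists s.
  pose S x : set R := [set sval q x | q in A].
  have Sn x : S x !=set0 by exists (sval q0 x); exists q0.
  have Sb x : has_lbound (S x).
    exists (- p (- x)) => _ [[q [sq qp]] /= _ <-].
    by apply: le_trans (sublinear_ge x sq); rewrite lerN2.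
  have Sle x (q : T) : A q -> inf (S x) <= sval q x.
    by move=> Aq; apply: ge_inf => //; exists q.
  have Ssub : sublinear (fun x => inf (S x)).
    split=> [x y|a x a0].
    - rewrite -lerBlDr; apply: lb_le_inf => // _ [q /= Aq <-].
      rewrite lerBlDr -lerBlDl; apply: lb_le_inf => // _ [r /= Ar <-].
      rewrite lerBlDl; have [qr|rq] := Atot _ _ Aq Ar.
      + apply: (le_trans (Sle _ _ Ar)); move/asboolP: qr => qr.
        have [[rD _] _] := svalP r.
        by apply: (le_trans (rD x y)); rewrite lerD2r.
      + apply: (le_trans (Sle _ _ Aq)); move/asboolP: rq => rq.
        have [[qD _] _] := svalP q.
        by apply: (le_trans (qD x y)); rewrite lerD2l.
    - rewrite mulrC -ler_pdivrMr//; apply: lb_le_inf => // _ [q /= Aq <-].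
      rewrite ler_pdivrMr// mulrC; apply: (le_trans (Sle _ _ Aq)).
      by have [[_ qZ] _] := svalP q; exact: qZ.
  have Sp x : inf (S x) <= p x.
    by apply: (le_trans (Sle _ _ Aq0)); have [_] := svalP q0; apply.
  pose t : T := exist (fun q => sublinear q /\ forall x, q x <= p x) _ (conj Ssub Sp).
  by exists t => s As; apply/asboolP => x; exact: Sle.
have qD x y : q (x + y) = q x + q y.
  apply/eqP; rewrite eq_le sq.1/=.
  have [q' [sq' q'q q'y]] := sublinear_lower y sq.
  pose t' : T := exist _ q' (conj sq' (fun x => le_trans (q'q x) (qp x))).
  have /qmin/(congr1 sval)/= e : leT (exist _ q (conj sq qp)) t' by apply/asboolP.
  by have := q'y x; rewrite e; lra.
have qN x : q (- x) = - q x.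
  by have := qD x (- x); rewrite subrr (sublinear0 sq); lra.
exists q; split=> // a x; have [a0|a0] := leP 0 a; first exact: sublinearZ.
rewrite -[a]opprK scaleNr qN (sublinearZ _ sq) ?oppr_ge0 ?ltW//; lra.
Qed.

(** A minimal map below the norm may be small at [v]. The norm is first lowered along [v], which
    forces the value at [- v] to be at most [- |v|]; every linear map below the result then takes
    the value [|v|] at [v]. *)
Lemma norming_functional (v : X) : exists phi : X -> R,
  [/\ forall x, `|phi x| <= `|x|, forall x y, phi (x + y) = phi x + phi y,
      forall (a : R) x, phi (a *: x) = a * phi x & phi v = `|v|].
Proof.
have sn : sublinear (fun x : X => `|x|).
  by split=> [x y|a x a0]; [exact: ler_normD|rewrite normrZ gtr0_norm].
have [p [sp pn pv]] := sublinear_lower v sn.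
have [q [qp qD qZ]] := sublinear_minorant sp.
have qN x : q (- x) = - q x by rewrite -scaleN1r qZ mulN1r.
have qn x : q x <= `|x| by exact: le_trans (qp x) (pn x).
exists q; split=> //.
- by move=> x; rewrite ler_norml qn andbT lerNl -qN -[leRHS]normrN.
- apply/eqP; rewrite eq_le qn/=.
  have := qp (- v); rewrite qN => h.
  have := pv (- v); rewrite addNr normr0; lra.
Qed.

End norming_functional.

(** * Laguerre polynomials *)

Section laguerre_polynomials.
Context {R : realType}.
Implicit Types (a b x t s : R) (n m k : nat).

Lemma gbinom0 x : gbinom x 0 = 1.
Proof. by rewrite /gbinom big_ord0 fact0 divr1. Qed.

Lemma natf_neq0 n : (n`!)%:R != 0 :> R.
Proof. by rewrite pnatr_eq0 -lt0n fact_gt0. Qed.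

Lemma mulSn_gbinom x m : m.+1%:R * gbinom (x + 1) m.+1 = (x + 1) * gbinom x m.
Proof.
rewrite /gbinom big_ord_recl /= subr0 factS natrM.
under eq_bigr => i _.
  rewrite /bump /= [X in x + 1 - X](_ : _ = 1 + i%:R); last by rewrite natrD.
  rewrite opprD addrA addrK; over.
have := natf_neq0 m; have : m.+1%:R != 0 :> R by rewrite pnatr_eq0.
by move: (m.+1%:R) => c h1 h2; field; rewrite h1 h2.
Qed.

Lemma gbinomS x m : gbinom x m.+1 * m.+1%:R = gbinom x m * (x - m%:R).
Proof.
rewrite /gbinom big_ord_recr /= factS natrM.
have := natf_neq0 m; have : m.+1%:R != 0 :> R by rewrite pnatr_eq0.
by move: (m.+1%:R) => c h1 h2; field; rewrite h1 h2.
Qed.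

Lemma mul_gbinomD1 x m : (x + 1 - m%:R) * gbinom (x + 1) m = (x + 1) * gbinom x m.
Proof.
case: m => [|m]; first by rewrite !gbinom0 subr0.
have m0 : m.+1%:R != 0 :> R by rewrite pnatr_eq0.
apply: (mulfI m0); rewrite mulrCA mulSn_gbinom.
rewrite [RHS]mulrCA [X in _ = _ * X]mulrC gbinomS -natr1; ring.
Qed.

Lemma gbinom_pascal x m : gbinom (x + 1) m.+1 = gbinom x m.+1 + gbinom x m.
Proof.
have m0 : m.+1%:R != 0 :> R by rewrite pnatr_eq0.
apply: (mulfI m0); rewrite mulSn_gbinom [RHS]mulrDr [X in _ = X + _]mulrC.
by rewrite gbinomS -natr1; ring.
Qed.

(** As formal polynomials, the relations between degrees and parameters are checked coefficient by
    coefficient, and derivatives are algebraic. *)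
Definition lagp n b : {poly R} :=
  \poly_(k < n.+1) ((-1) ^+ k * gbinom (n%:R + b) (n - k) / (k`!)%:R).

Lemma horner_lagp n b t : (lagp n b).[t] = laguerre n b t.
Proof.
rewrite horner_poly /laguerre; apply: eq_bigr => k _.
by rewrite mulrAC.
Qed.

Lemma lagp0 b : lagp 0 b = 1.
Proof.
apply/polyP => k; rewrite coef_poly coef1; case: k => [|k]//=.
by rewrite gbinom0 fact0 expr0 !mul1r invr1.
Qed.

Lemma deriv_lagp n b : (lagp n.+1 b)^`() = - lagp n (b + 1).
Proof.
apply/polyP => k; rewrite coef_deriv coefN !coef_poly ltnS.
case: ifP => _; last by rewrite mul0rn oppr0.
rewrite subSS -natr1 [b + 1]addrC addrA exprS factS natrM -[LHS]mulr_natr.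
have := natf_neq0 k; have : k.+1%:R != 0 :> R by rewrite pnatr_eq0.
by move: (k.+1%:R) => c h1 h2; field; rewrite h1 h2.
Qed.

Lemma lagpS n b : lagp n.+1 (b + 1) = lagp n.+1 b + lagp n (b + 1).
Proof.
apply/polyP => k; rewrite coefD !coef_poly !ltnS.
rewrite [b + 1]addrC !addrA [n%:R + 1]natr1.
case: (ltngtP k n.+1) => [kn|kn|->].
- rewrite -ltnS kn subSn //.
  rewrite [n.+1%:R + 1 + b]addrAC gbinom_pascal; ring.
- by rewrite !ifF ?addr0//; lia.
- by rewrite ltnn subnn !gbinom0 addr0.
Qed.

(** Leads from the parameter [b + 1] back to [b]. It drives the induction for the
    Christoffel-Darboux formula and turns Laguerre coefficients for [b + 1] into weighted increments
    of those for [b]. *)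
Lemma lagp_mulX n b :
  'X * lagp n (b + 1) = (n%:R + b + 1) *: lagp n b - n.+1%:R *: lagp n.+1 b.
Proof.
have absorb m : (n%:R + b + 1) * gbinom (n%:R + b) m =
    m.+1%:R * gbinom (n.+1%:R + b) m.+1.
  by rewrite -[n.+1%:R]natr1 [n%:R + 1 + b]addrAC mulSn_gbinom.
apply/polyP => k; rewrite coefXM coefB !coefZ !coef_poly.
case: k => [|k] /=; rewrite ?eqxx /=.
  by rewrite fact0 !divr1 !subn0 expr0 !mul1r absorb subrr.
rewrite !ltnS subSS [b + 1]addrC addrA [n%:R + 1]natr1.
have h1 := natf_neq0 k; have h2 : k.+1%:R != 0 :> R by rewrite pnatr_eq0.
case: (ltngtP k n) => [kn|kn|->].
- have nk : (n - k = (n - k.+1).+1)%N by lia.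
  rewrite nk factS natrM.
  have := absorb (n - k.+1)%N; rewrite -nk (natrB _ (ltnW kn)) => e.
  rewrite exprS.
  have -> : (n%:R + b + 1) * (-1 * (-1) ^+ k * gbinom (n%:R + b) (n - k.+1)
     / (k.+1%:R * k`!%:R)) = (-1 * (-1) ^+ k / (k.+1%:R * k`!%:R)) *
       ((n%:R + b + 1) * gbinom (n%:R + b) (n - k.+1)) by ring.
  rewrite e -!natr1; rewrite -natr1 in h2.
  by field; rewrite h1 h2.
- by rewrite !mulr0 subr0.
- rewrite subnn !gbinom0 mulr0 sub0r exprS factS natrM.
  have {}h2 : n.+1%:R != 0 :> R by rewrite pnatr_eq0.
  have {}h1 := natf_neq0 n.
  rewrite -natr1 in h2 *; by field; rewrite h1 h2.
Qed.

(* Rodrigues' formula: the left-hand side is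
   [e^s s^(-b) (s^(b+1) e^(-s) L_n^(b+1)(s))']. *)
Lemma lagp_rodrigues n b :
  ((b + 1)%:P - 'X) * lagp n (b + 1) + 'X * (lagp n (b + 1))^`() =
  n.+1%:R *: lagp n.+1 b.
Proof.
have key : 'X * (lagp n (b + 1))^`() =
    (n%:R + b + 1) *: lagp n b - (b + 1) *: lagp n (b + 1).
  apply/polyP => k; rewrite coefXM coefB !coefZ coef_deriv !coef_poly.
  have e : (k <= n)%N -> (k%:R + b + 1) * gbinom (n%:R + (b + 1)) (n - k) =
     (n%:R + b + 1) * gbinom (n%:R + b) (n - k).
    by move=> kn; rewrite -mul_gbinomD1 natrB// addrA; congr (_ * _); ring.
  have -> : (if k == 0%N then 0 else (if (k.-1.+1 < n.+1)%N then
      (-1) ^+ k.-1.+1 * gbinom (n%:R + (b + 1)) (n - k.-1.+1) / (k.-1.+1)`!%:R else 0)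
      *+ k.-1.+1) = (if (k < n.+1)%N then
      k%:R * ((-1) ^+ k * gbinom (n%:R + (b + 1)) (n - k) / k`!%:R) else 0).
    case: k {e} => [|k]; first by rewrite mul0r.
    rewrite -[LHS]mulr_natr /=; case: ifP; rewrite ?mul0r// => _; ring.
  rewrite ltnS; case: ifP => [/e{}e|_]; last by rewrite !mulr0 subr0.
  have -> : (n%:R + b + 1) * ((-1) ^+ k * gbinom (n%:R + b) (n - k) / k`!%:R) =
    ((-1) ^+ k / k`!%:R) * ((n%:R + b + 1) * gbinom (n%:R + b) (n - k)) by ring.
  rewrite -e; ring.
rewrite key mulrBl lagp_mulX mul_polyC.
by move: (_ *: lagp n (b + 1)) (_ *: lagp n b) (_ *: lagp n.+1 b) => u v w; ring.
Qed.

End laguerre_polynomials.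

(** * Integration on the half-line *)

Section half_line.
Context {R : realType}.
Local Notation mu := (@lebesgue_measure R).
Local Notation D := [set` `]0%R, +oo[ : interval R].
Implicit Types (a b s t : R) (h F : R -> R).

Lemma in_half_line s : D s = (0 < s) :> Prop.
Proof. by rewrite /= in_itv/= andbT. Qed.

(** The integral of a nonnegative function is a supremum over simple functions below it, so no
    measurability enters. This serves norms of [X]-valued differences, whose measurability is not
    established. *)
Lemma ge0_le_lower_integral d (T : measurableType d) (m : {measure set T -> \bar R})
    (A : set T) (f g : T -> \bar R) :
  (forall x, A x -> 0 <= f x)%E -> (forall x, A x -> f x <= g x)%E ->
  (\int[m]_(x in A) f x <= \int[m]_(x in A) g x)%E.
Proof.
move=> f0 fg; rewrite !ge0_integralE//; last first.
  by move=> x Ax; exact: le_trans (f0 _ Ax) (fg _ Ax).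
apply: ereal_sup_le => _ [h /= hf <-]; exists h => //= x.
apply: (le_trans (hf x)); rewrite /patch; case: ifPn => //.
by rewrite inE => /fg.
Qed.

Definition cont_pos (V : normedModType R) (h : R -> V) :=
  forall s, 0 < s -> {for s, continuous h}.

Lemma cont_pos_measurable h : cont_pos h -> measurable_fun D h.
Proof.
move=> ch; apply: open_continuous_measurable_fun; first exact: interval_open.
by move=> s; rewrite inE in_half_line => /ch.
Qed.

Lemma integrable_le h h' : measurable_fun D h ->
  mu.-integrable D (EFin \o h') -> (forall s, 0 < s -> `|h s| <= h' s) ->
  mu.-integrable D (EFin \o h).
Proof.
move=> mh ih hh'; apply: le_integrable ih => //; first exact/measurable_EFinP.
move=> s; rewrite in_half_line => /hh' e /=; rewrite lee_fin.
exact: le_trans e (ler_norm _).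
Qed.

Lemma integrable_pos_fin h : measurable_fun D h -> (forall s, 0 < s -> 0 <= h s) ->
  (\int[mu]_(s in D) (h s)%:E < +oo)%E -> mu.-integrable D (EFin \o h).
Proof.
move=> mh h0 ih; apply/integrableP; split; first exact/measurable_EFinP.
apply: le_lt_trans ih; rewrite le_eqVlt; apply/orP; left; apply/eqP.
by apply: eq_integral => s; rewrite inE in_half_line => /h0 ? /=; rewrite ger0_norm.
Qed.

Lemma integrableRZ (c : R) h : mu.-integrable D (EFin \o h) ->
  mu.-integrable D (EFin \o (fun s => c * h s)).
Proof.
by move=> ih; apply: (@eq_integrable _ _ _ mu D _ (fun s => c%:E * (EFin \o h) s)%E);
  [|move=> s _; rewrite /= EFinM|exact: integrableZl].
Qed.

Lemma integrableRD h h' : mu.-integrable D (EFin \o h) ->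
  mu.-integrable D (EFin \o h') ->
  mu.-integrable D (EFin \o (fun s => h s + h' s)).
Proof.
by move=> ih ih'; apply: (@eq_integrable _ _ _ mu D _ ((EFin \o h) \+ (EFin \o h'))%E);
  [|move=> s _; rewrite /= EFinD|exact: integrableD].
Qed.

Lemma integrableRB h h' : mu.-integrable D (EFin \o h) ->
  mu.-integrable D (EFin \o h') ->
  mu.-integrable D (EFin \o (fun s => h s - h' s)).
Proof.
by move=> ih ih'; apply: (@eq_integrable _ _ _ mu D _ ((EFin \o h) \- (EFin \o h'))%E);
  [|move=> s _; rewrite /= EFinB|exact: integrableB].
Qed.

(** An exhaustion that stays away from both infinity and 0, where [s ^ b] is unbounded for [b < 0].
    The first set is empty. *)
Definition exh (k : nat) : set R := `]k.+1%:R^-1, k.+1%:R].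

Lemma measurable_exh k : measurable (exh k).
Proof. exact: measurable_itv. Qed.

Lemma measurable_exhC k : measurable (D `\` exh k).
Proof. by apply: measurableD => //; exact: measurable_exh. Qed.

Lemma exh_sub k : exh k `<=` D.
Proof.
move=> s; rewrite /exh/= !in_itv/= andbT => /andP[+ _].
by apply: lt_trans; rewrite invr_gt0.
Qed.

Lemma exh_nd : nondecreasing_seq exh.
Proof.
move=> k l kl; rewrite subsetEset => s; rewrite /exh/= !in_itv/= => /andP[ks sk].
rewrite (le_trans sk) ?ler_nat// andbT (le_lt_trans _ ks)//.
by rewrite lef_pV2 ?posrE// ler_nat.
Qed.

Lemma bigcup_exh : \bigcup_k exh k = D.
Proof.
apply/seteqP; split=> [s [k _]|s]; first exact: exh_sub.
rewrite in_half_line => s0.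
pose k := (Num.bound s + Num.bound s^-1)%N.
exists k => //; rewrite /exh/= in_itv/=; apply/andP; split.
- rewrite -[ltRHS]invrK ltf_pV2 ?posrE ?invr_gt0//.
  apply: lt_le_trans (archi_boundP _) _; first by rewrite invr_ge0 ltW.
  by rewrite ler_nat /k; lia.
- apply/ltW/(lt_le_trans (archi_boundP (ltW s0))).
  by rewrite ler_nat /k; lia.
Qed.

Lemma ge0_cvg_integral_exh h : measurable_fun D h -> (forall s, 0 < s -> 0 <= h s) ->
  (\int[mu]_(s in exh k) (h s)%:E @[k --> \oo] --> \int[mu]_(s in D) (h s)%:E)%E.
Proof.
move=> mh h0; rewrite -bigcup_exh; apply: ge0_nondecreasing_set_cvg_integral => //.
- exact: exh_nd.
- by move=> k; exact: measurable_exh.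
- move=> k; apply/measurable_EFinP; apply: measurable_funS mh => //.
  exact: exh_sub.
- by move=> k s /exh_sub; rewrite in_half_line lee_fin => /h0.
Qed.

Lemma ge0_cvg_Rintegral_exh h : mu.-integrable D (EFin \o h) ->
  (forall s, 0 < s -> 0 <= h s) ->
  Rintegral mu (exh k) h @[k --> \oo] --> Rintegral mu D h.
Proof.
move=> ih h0; apply: fine_cvg; rewrite fineK; last exact: integrable_fin_num.
apply: ge0_cvg_integral_exh => //.
by apply/measurable_EFinP; exact: measurable_int ih.
Qed.

Lemma Rintegral_exhC h k : mu.-integrable D (EFin \o h) ->
  Rintegral mu D h - Rintegral mu (exh k) h = Rintegral mu (D `\` exh k) h.
Proof.
move=> ih; rewrite -{1}(setDUK (@exh_sub k)) Rintegral_setU; first last.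
- by apply/disj_setPS => s [? [_ ?]].
- by rewrite setDUK//; exact: exh_sub.
- exact: measurable_exhC.
- exact: measurable_exh.
- by rewrite addrAC subrr add0r.
Qed.

Lemma ge0_cvg_Rintegral_exhC h : mu.-integrable D (EFin \o h) ->
  (forall s, 0 < s -> 0 <= h s) ->
  Rintegral mu (D `\` exh k) h @[k --> \oo] --> 0.
Proof.
move=> ih h0; have := ge0_cvg_Rintegral_exh ih h0.
move=> /(cvgB (cvg_cst (Rintegral mu D h))); rewrite subrr.
apply: cvg_trans; apply: near_eq_cvg; near=> k => /=.
by rewrite -Rintegral_exhC.
Unshelve. all: by end_near. Qed.

Lemma cvg_Rintegral_exh h : mu.-integrable D (EFin \o h) ->
  Rintegral mu (exh k) h @[k --> \oo] --> Rintegral mu D h.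
Proof.
move=> ih; have ihn : mu.-integrable D (EFin \o (fun s => `|h s|)).
  exact: (integrable_norm ih).
have := ge0_cvg_Rintegral_exhC ihn (fun s _ => normr_ge0 _).
move=> /cvgr0Pnorm_lt c0; apply/cvgrPdist_lt => e e0.
near=> k; rewrite Rintegral_exhC//.
apply: le_lt_trans (le_normr_Rintegral _ _) _; first exact: measurable_exhC.
  by apply: integrableS ih => //; solve [exact: measurable_exhC|exact: subDsetl].
have : `|Rintegral mu (D `\` exh k) (fun s => `|h s|)| < e.
  by near: k; exact: c0.
by apply: le_lt_trans; exact: ler_norm.
Unshelve. all: by end_near. Qed.

Lemma Rintegral_FTC h F a b : 0 < a -> a <= b -> cont_pos h ->
  (forall s, 0 < s -> is_derive s 1 F (h s)) ->
  mu.-integrable `]a, b] (EFin \o h) /\ Rintegral mu `]a, b] h = F b - F a.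
Proof.
move=> a0 + ch dF; rewrite le_eqVlt => /predU1P[<-|ab].
  rewrite set_itvoc0 Rintegral_set0 subrr; split=> //.
  by apply/integrableP; split; [exact: measurable_fun_set0|rewrite integral_set0].
have wc : {within `[a, b], continuous h}.
  apply: continuous_in_subspaceT => s; rewrite inE/= in_itv/= => /andP[as' _].
  by apply: ch; exact: lt_le_trans as'.
have ic : mu.-integrable `[a, b] (EFin \o h).
  by apply: continuous_compact_integrable => //; exact: segment_compact.
have io : mu.-integrable `]a, b] (EFin \o h).
  by apply: integrableS ic => //; exact: subset_itv_oc_cc.
split=> //; rewrite Rintegral_itv_obnd_cbnd//.
have cF s : 0 < s -> {for s, continuous F}.
  move=> /dF [d _]; exact/differentiable_continuous/derivable1_diffP.
rewrite /Rintegral (@continuous_FTC2 _ h F)//.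
- split.
  + move=> s; rewrite in_itv/= => /andP[as' _].
    by have [] := dF s (lt_trans a0 as').
  + by apply: cvg_at_right_filter; exact: cF.
  + by apply: cvg_at_left_filter; apply: cF; exact: lt_trans ab.
- move=> s; rewrite in_itv/= => /andP[as' _].
  by have [_ <-] := dF s (lt_trans a0 as'); rewrite derive1E.
Qed.

(** On each set of the exhaustion the integral is an increment of [F], hence at most [2 M]; monotone
    convergence carries the bound to the half-line. *)
Lemma ge0_integrable_FTC h F (M : R) : cont_pos h ->
  (forall s, 0 < s -> is_derive s 1 F (h s)) -> (forall s, 0 < s -> 0 <= h s) ->
  (forall s, 0 < s -> `|F s| <= M) -> mu.-integrable D (EFin \o h).
Proof.
move=> ch dF h0 FM; have mh := cont_pos_measurable ch.
apply: integrable_pos_fin => //.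
have H := ge0_cvg_integral_exh mh h0.
apply: (@le_lt_trans _ _ (M + M)%:E); last exact: ltry.
rewrite -(cvg_lim (@ereal_hausdorff R) H) => //.
apply: lime_le; first by apply/cvg_ex; eexists; exact: H.
near=> k.
have k0 : 0 < k.+1%:R^-1 :> R by rewrite invr_gt0.
have kk : k.+1%:R^-1 <= k.+1%:R :> R.
  by rewrite (@le_trans _ _ 1)// ?ler1n// invf_le1// ler1n.
have [ih e] := Rintegral_FTC k0 kk ch dF.
rewrite -(fineK (integrable_fin_num _ ih))//.
rewrite lee_fin; change (Rintegral mu `]k.+1%:R^-1, k.+1%:R] h <= M + M).
rewrite e; have := FM _ k0; have := FM _ (lt_le_trans k0 kk).
by rewrite !ler_norml; lra.
Unshelve. all: by end_near. Qed.

Lemma Rintegral_FTC_half_line h F (A B : R) : cont_pos h ->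
  (forall s, 0 < s -> is_derive s 1 F (h s)) -> mu.-integrable D (EFin \o h) ->
  F (k.+1%:R^-1) @[k --> \oo] --> A -> F (k.+1%:R) @[k --> \oo] --> B ->
  Rintegral mu D h = B - A.
Proof.
move=> ch dF ih FA FB.
have H := cvg_Rintegral_exh ih.
suff H' : Rintegral mu (exh k) h @[k --> \oo] --> B - A.
  exact: (cvg_unique (@Rhausdorff R) H H').
have FBA : F k.+1%:R - F k.+1%:R^-1 @[k --> \oo] --> B - A by exact: cvgB.
apply: cvg_trans FBA; apply: near_eq_cvg; near=> k.
have k0 : 0 < k.+1%:R^-1 :> R by rewrite invr_gt0.
have kk : k.+1%:R^-1 <= k.+1%:R :> R.
  by rewrite (@le_trans _ _ 1)// ?ler1n// invf_le1// ler1n.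
by have [_ ->] := Rintegral_FTC k0 kk ch dF.
Unshelve. all: by end_near. Qed.

End half_line.

(** * The weight *)

Section laguerre_weight.
Context {R : realType}.
Local Notation mu := (@lebesgue_measure R).
Local Notation D := [set` `]0%R, +oo[ : interval R].
Implicit Types (a b s t : R) (f g h F G : R -> R) (p q : {poly R}).

Lemma cont_posD f g : cont_pos f -> cont_pos g -> cont_pos (fun s => f s + g s).
Proof. by move=> cf cg s s0; apply: cvgD; [exact: cf|exact: cg]. Qed.

Lemma cont_posM f g : cont_pos f -> cont_pos g -> cont_pos (fun s => f s * g s).
Proof. by move=> cf cg s s0; apply: cvgM; [exact: cf|exact: cg]. Qed.

Lemma cont_pos_derive f g : (forall s, 0 < s -> is_derive s 1 f (g s)) -> cont_pos f.
Proof.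
move=> df s /df [d _]; exact/differentiable_continuous/derivable1_diffP.
Qed.

Definition weight b s : R := s `^ b * expR (- s).

Lemma weight_gt0 b s : 0 < s -> 0 < weight b s.
Proof. by move=> s0; rewrite mulr_gt0// ?powR_gt0// expR_gt0. Qed.

Lemma weight_ge0 b s : 0 <= weight b s.
Proof. by rewrite mulr_ge0// ?powR_ge0// expR_ge0. Qed.

Lemma weightS b s : 0 < s -> weight (b + 1) s = s * weight b s.
Proof.
move=> s0; rewrite /weight powRD; last by rewrite (gt_eqF s0) implybT.
by rewrite powRr1 1?ltW// mulrAC mulrC.
Qed.

Lemma is_derive_weightS b s : 0 < s ->
  is_derive s 1 (weight (b + 1)) (weight b s * (b + 1 - s)).
Proof.
move=> s0; have H1 := @is_derive1_powR R (b + 1) s s0.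
have H2 : is_derive s 1 (fun u : R => expR (- u)) (- expR (- s)).
  apply: is_derive_eq; rewrite /GRing.scale/=; ring.
apply: (is_derive_eq (is_deriveM H1 H2)).
have := weightS b s0; rewrite /weight /GRing.scale/= addrK => e.
by rewrite mulrN e; ring.
Qed.

Lemma cont_pos_weight b : cont_pos (weight b).
Proof.
rewrite -(subrK 1 b); exact: cont_pos_derive (is_derive_weightS (b - 1)).
Qed.

(** The inequality [1 + x <= exp x] at [x = s / (m + 1)] gives
    [(1 + s) / (m + 1) <= exp (s / (m + 1))]; take the m-th power. Using [m + 1] instead of [m]
    covers [m = 0]. *)
Lemma expn_expR_bounded m : exists2 C : R, 0 <= C &
  forall s, 0 <= s -> (1 + s) ^+ m * expR (- s) <= C.
Proof.
exists (m.+1%:R ^+ m); first by rewrite exprn_ge0.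
move=> s s0; have m0 : 0 < m.+1%:R :> R by [].
rewrite expRN ler_pdivrMr ?expR_gt0//.
have := expR_ge1Dx (s / m.+1%:R) => le1.
have s10 : 0 <= (1 + s) / m.+1%:R by rewrite divr_ge0// addr_ge0.
have le2 : (1 + s) / m.+1%:R <= expR (s / m.+1%:R).
  apply: le_trans le1; rewrite mulrDl lerD2r mul1r invf_le1//.
  by rewrite ler1n.
have -> : (1 + s) ^+ m = m.+1%:R ^+ m * ((1 + s) / m.+1%:R) ^+ m.
  by rewrite -exprMn mulrCA divff ?gt_eqF// mulr1.
rewrite ler_wpM2l ?exprn_ge0//.
apply: (@le_trans _ _ (expR (s / m.+1%:R) ^+ m)).
  by apply: lerXn2r => //; rewrite nnegrE// expR_ge0.
rewrite -expRM_natl ler_expR mulrCA ler_piMr// ler_pdivrMr// mul1r.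
by rewrite ler_nat.
Qed.

(** A class closed under sums and products that contains the polynomials and [1 / (1 + s)], so that
    integrability against every weight with [b > -1] becomes a syntactic matter. *)
Definition pgrow F := cont_pos F /\
  exists C (m : nat), 0 <= C /\ forall s, 0 < s -> `|F s| <= C * (1 + s) ^+ m.

Lemma pgrowD F G : pgrow F -> pgrow G -> pgrow (fun s => F s + G s).
Proof.
move=> [cF [C [m [C0 FC]]]] [cG [E [k [E0 GE]]]]; split; first exact: cont_posD.
exists (C + E), (m + k)%N; split; first exact: addr_ge0.
move=> s s0; rewrite (le_trans (ler_normD _ _))// mulrDl lerD//.
- apply: (le_trans (FC s s0)); rewrite ler_wpM2l// exprD ler_peMr//.
    by rewrite exprn_ge0//; lra.
  by rewrite exprn_ege1//; lra.
- apply: (le_trans (GE s s0)); rewrite ler_wpM2l// exprD ler_peMl//.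
    by rewrite exprn_ge0//; lra.
  by rewrite exprn_ege1//; lra.
Qed.

Lemma pgrowM F G : pgrow F -> pgrow G -> pgrow (fun s => F s * G s).
Proof.
move=> [cF [C [m [C0 FC]]]] [cG [E [k [E0 GE]]]]; split; first exact: cont_posM.
exists (C * E), (m + k)%N; split; first exact: mulr_ge0.
move=> s s0; rewrite normrM exprD mulrACA.
by rewrite ler_pM//; [exact: FC|exact: GE].
Qed.

Lemma pgrow_cst (c : R) : pgrow (fun=> c).
Proof.
split; first by move=> s _; exact: cvg_cst.
by exists `|c|, 0%N; split=> // s _; rewrite expr0 mulr1.
Qed.

Lemma pgrow_id : pgrow (fun s => s).
Proof.
split; first by move=> s _; exact: cvg_id.
by exists 1, 1%N; split=> // s s0; rewrite expr1 mul1r gtr0_norm//; lra.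
Qed.

Lemma pgrowB F G : pgrow F -> pgrow G -> pgrow (fun s => F s - G s).
Proof.
move=> gF gG; rewrite (_ : (fun s => _) = (fun s => F s + -1 * G s)).
  by apply: pgrowD => //; apply: pgrowM => //; exact: pgrow_cst.
by apply/funext => s; rewrite mulN1r.
Qed.

Lemma pgrow_horner p : pgrow (horner p).
Proof.
elim/poly_ind: p => [|p c ih].
  by rewrite (_ : horner 0 = (fun=> 0)); [exact: pgrow_cst|
    apply/funext => s; rewrite horner0].
rewrite (_ : horner _ = (fun s => p.[s] * s + c)); last first.
  by apply/funext => s; rewrite hornerMXaddC.
by apply: pgrowD; [apply: pgrowM => //; exact: pgrow_id|exact: pgrow_cst].
Qed.

Lemma pgrow_inv1D : pgrow (fun s => (1 + s)^-1).
Proof.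
split.
  move=> s s0; apply: cvgV; first by rewrite gt_eqF//; lra.
  by apply: cvgD; [exact: cvg_cst|exact: cvg_id].
exists 1, 0%N; split=> // s s0; rewrite expr0 mul1r ger0_norm; last first.
  by rewrite invr_ge0; lra.
by rewrite invf_le1; lra.
Qed.

(** With [u = s / (1 + s)] one has [u' = (1 + s) ^ -2], so the function is the derivative of
    [u ^ (b + 1) / (b + 1)], which is bounded because [0 < u < 1]. This treats the singularity at 0
    and the tail at once. *)
Lemma integrable_rational_majorant b : -1 < b ->
  mu.-integrable D (EFin \o (fun s => (s / (1 + s)) `^ b * (1 + s) ^- 2)).
Proof.
move=> b1.
have b10 : b + 1 != 0 by rewrite gt_eqF//; lra.
pose u (s : R) : R := 1 - (1 + s)^-1.
have uE s : 0 < s -> s / (1 + s) = u s.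
  by move=> s0; rewrite /u; field; rewrite gt_eqF//; lra.
have u0 s : 0 < s -> 0 < u s.
  by move=> s0; rewrite -uE// divr_gt0//; lra.
have du s : 0 < s -> is_derive s 1 u ((1 + s) ^- 2).
  move=> s0; have h : is_derive s 1 (fun x : R => 1 + x) 1.
    have := is_deriveD (is_derive_cst (1 : R) s 1) (is_derive_id s 1).
    by rewrite add0r.
  have s1 : 1 + s != 0 by rewrite gt_eqF//; lra.
  have := @is_deriveV _ (fun x : R => 1 + x) s 1 1 s1 h.
  move=> h2; apply: (is_derive_eq (is_deriveB (is_derive_cst (1 : R) s 1) h2)).
  by rewrite sub0r /GRing.scale/= mulr1 opprK.
have dF s : 0 < s -> is_derive s 1 (fun x => (b + 1)^-1 * u x `^ (b + 1))
    (u s `^ b * (1 + s) ^- 2).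
  move=> s0; have := is_derive1_comp (@is_derive1_powR R (b + 1) _ (u0 s s0)) (du s s0).
  rewrite addrK => h.
  apply: (is_derive_eq (is_deriveM (is_derive_cst (b + 1)^-1 s 1) h)).
  rewrite scaler0 addr0 /GRing.scale/=.
  by rewrite /cst; field; rewrite b10 andbT gt_eqF//; lra.
have cu : cont_pos (fun s => u s `^ b * (1 + s) ^- 2).
  apply: cont_posM => s s0; last first.
    apply: cvgV; first by rewrite expf_neq0// gt_eqF//; lra.
    by apply: cvgM; (apply: cvgD; [exact: cvg_cst|exact: cvg_id]).
  change {for s, continuous ((fun x : R => x `^ b) \o u)}.
  apply: continuous_comp; first exact: (cont_pos_derive du).
  have [d _] := @is_derive1_powR R b _ (u0 s s0).
  exact/differentiable_continuous/derivable1_diffP.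
apply: (@integrable_le _ _ (fun s => u s `^ b * (1 + s) ^- 2)).
- apply: cont_pos_measurable => s s0.
  apply: cvg_trans (_ : (fun s => u s `^ b * (1 + s) ^- 2) @ s --> _).
    apply: near_eq_cvg; near=> x; rewrite uE//; near: x.
    exact: lt_nbhsr.
  by rewrite uE//; exact: cu.
- apply: (@ge0_integrable_FTC _ _ _ `|(b + 1)^-1| cu dF).
    by move=> s s0; rewrite mulr_ge0// ?powR_ge0// invr_ge0 exprn_ge0//; lra.
  move=> s s0; rewrite normrM ler_piMr// ger0_norm ?powR_ge0//.
  have : u s `^ (b + 1) <= 1 `^ (b + 1).
    apply: ge0_ler_powR; rewrite ?nnegrE//; [lra|exact: ltW (u0 _ s0)|].
    by rewrite /u gerBl invr_ge0; lra.
  by rewrite powR1.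
- move=> s s0; rewrite uE// ger0_norm// mulr_ge0// ?powR_ge0//.
  by rewrite invr_ge0 exprn_ge0//; lra.
Unshelve. all: by end_near. Qed.

Lemma le_powR_expn a s : 0 <= s -> (1 + s) `^ a <= (1 + s) ^+ Num.bound `|a|.
Proof.
move=> s0; rewrite -powR_mulrn; last by lra.
apply: ler_powR; first by lra.
by rewrite (le_trans (ler_norm a))// ltW// archi_boundP.
Qed.

Lemma integrable_weight_expn b (m : nat) : -1 < b ->
  mu.-integrable D (EFin \o (fun s => weight b s * (1 + s) ^+ m)).
Proof.
(* After [s ^ b = (s / (1 + s)) ^ b * (1 + s) ^ b], the exponential has to absorb [(1 + s) ^ b],
   [(1 + s) ^ m] and the [(1 + s) ^ 2] of the majorant. *)
move=> b1; have [C C0 hC] := expn_expR_bounded (Num.bound `|b| + m + 2).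
have i1 := integrable_rational_majorant b1.
have {}i1 := integrableRZ C i1.
have cw : cont_pos (fun s => weight b s * (1 + s) ^+ m).
  apply: cont_posM; first exact: cont_pos_weight.
  have [+ _] := pgrow_horner ((1 + 'X) ^+ m).
  rewrite (_ : horner _ = (fun s => (1 + s) ^+ m))//.
  by apply/funext => s; rewrite !hornerE.
apply: (@integrable_le _ _ (fun s => C * ((s / (1 + s)) `^ b * (1 + s) ^- 2))) => //.
  exact: cont_pos_measurable.
move=> s s0; have s1 : 0 < 1 + s by lra.
rewrite ger0_norm; last by rewrite mulr_ge0// ?weight_ge0// exprn_ge0 ?ltW.
have -> : weight b s = (s / (1 + s)) `^ b * (1 + s) `^ b * expR (- s).
  rewrite /weight -powRM; last 2 first.
  - by rewrite divr_ge0 ?ltW.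
  - exact: ltW.
  by rewrite divfK// gt_eqF.
rewrite mulrCA -!mulrA ler_wpM2l ?powR_ge0// mulrC.
rewrite mulrC ler_pdivlMr ?exprn_gt0//.
apply: le_trans (hC s (ltW s0)); rewrite !exprD.
rewrite -!mulrA mulrCA [expR _ * _]mulrC -!mulrA ler_wpM2r//.
  by rewrite !mulr_ge0// ?exprn_ge0 ?expR_ge0 ?ltW.
exact: le_powR_expn (ltW s0).
Qed.

End laguerre_weight.

(** * Orthogonality *)

Section laguerre_orthogonality.
Context {R : realType}.
Local Notation mu := (@lebesgue_measure R).
Local Notation D := [set` `]0%R, +oo[ : interval R].
Implicit Types (a b s t : R) (f g h F G : R -> R) (p q : {poly R}).

Lemma integrable_weight b F : -1 < b -> pgrow F ->
  mu.-integrable D (EFin \o (fun s => weight b s * F s)).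
Proof.
move=> b1 [cF [C [m [C0 FC]]]].
apply: (integrable_le _ (integrableRZ C (integrable_weight_expn m b1))).
  by apply: cont_pos_measurable; apply: cont_posM => //; exact: cont_pos_weight.
move=> s s0; rewrite normrM ger0_norm ?weight_ge0// mulrCA.
by rewrite ler_wpM2l ?weight_ge0// FC.
Qed.

Definition wint b F : R := Rintegral mu D (fun s => weight b s * F s).

Lemma eq_wint b F G : (forall s, 0 < s -> F s = G s) -> wint b F = wint b G.
Proof.
by move=> FG; apply: eq_Rintegral => s; rewrite inE in_half_line => /FG ->.
Qed.

Lemma wintD b F G : -1 < b -> pgrow F -> pgrow G ->
  wint b (fun s => F s + G s) = wint b F + wint b G.
Proof.
move=> b1 gF gG; rewrite /wint -RintegralD//; [|exact: integrable_weight..].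
by apply: eq_Rintegral => s _; rewrite mulrDr.
Qed.

Lemma wintZ b (c : R) F : -1 < b -> pgrow F ->
  wint b (fun s => c * F s) = c * wint b F.
Proof.
move=> b1 gF; rewrite /wint -RintegralZl//; last exact: integrable_weight.
by apply: eq_Rintegral => s _; rewrite mulrCA.
Qed.

Lemma wintB b F G : -1 < b -> pgrow F -> pgrow G ->
  wint b (fun s => F s - G s) = wint b F - wint b G.
Proof.
move=> b1 gF gG; rewrite /wint -RintegralB//; [|exact: integrable_weight..].
by apply: eq_Rintegral => s _; rewrite mulrBr.
Qed.

Lemma le_wint b F G : -1 < b -> pgrow F -> pgrow G ->
  (forall s, 0 < s -> F s <= G s) -> wint b F <= wint b G.
Proof.
move=> b1 gF gG FG; apply: le_Rintegral => //; [exact: integrable_weight..|].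
by move=> s; rewrite in_half_line => s0; rewrite ler_wpM2l ?weight_ge0// FG.
Qed.

Lemma wint_ge0 b F : (forall s, 0 < s -> 0 <= F s) -> 0 <= wint b F.
Proof.
move=> F0; apply: Rintegral_ge0 => s; rewrite in_half_line => /F0 ?.
by rewrite mulr_ge0// weight_ge0.
Qed.

Lemma wint_shift b F : wint (b + 1) F = wint b (fun s => s * F s).
Proof.
apply: eq_Rintegral => s; rewrite inE in_half_line => s0.
by rewrite weightS// mulrAC mulrC mulrA mulrAC.
Qed.

Lemma Gamma_wint b : Gamma (b + 1) = wint b (fun=> 1).
Proof. by apply: eq_Rintegral => s _; rewrite addrK mulr1. Qed.

Lemma Rintegral_subset_le (A : set R) h : measurable A -> A `<=` D ->
  mu.-integrable D (EFin \o h) -> (forall s, 0 < s -> 0 <= h s) ->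
  Rintegral mu A h <= Rintegral mu D h.
Proof.
move=> mA AD ih h0; apply: fine_le.
- by apply: integrable_fin_num => //; apply: integrableS ih.
- by apply: integrable_fin_num.
- apply: ge0_subset_integral => //; first exact: measurable_int ih.
  by move=> s; rewrite in_half_line lee_fin => /h0.
Qed.

Lemma Rintegral_itv_gt0 h a b : 0 < a -> a < b -> cont_pos h ->
  (forall s, 0 < s -> 0 < h s) -> 0 < Rintegral mu `]a, b] h.
Proof.
move=> a0 ab ch h0.
have wc : {within `[a, b], continuous h}.
  apply: continuous_in_subspaceT => s; rewrite inE/= in_itv/= => /andP[as' _].
  by apply: ch; exact: lt_le_trans as'.
have ic : mu.-integrable `[a, b] (EFin \o h).
  by apply: continuous_compact_integrable => //; exact: segment_compact.
have io : mu.-integrable `]a, b] (EFin \o h).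
  by apply: integrableS ic => //; exact: subset_itv_oc_cc.
have [c + cmin] := EVT_min (ltW ab) wc.
rewrite in_itv/= => /andP[ac cb].
have hc0 : 0 < h c by apply: h0; exact: lt_le_trans ac.
apply: (@lt_le_trans _ _ (h c * (b - a))); first by rewrite mulr_gt0// subr_gt0.
have muab : mu `]a, b]%classic = (b - a)%:E.
  by rewrite lebesgue_measure_itv/= lte_fin ab -EFinB.
have -> : h c * (b - a) = Rintegral mu `]a, b] (fun=> h c).
  by rewrite Rintegral_cst// [X in fine X](muab).
apply: le_Rintegral => //.
- have icst : mu.-integrable `[a, b] (EFin \o (fun=> h c)).
    apply: continuous_compact_integrable; first exact: segment_compact.
    by apply: continuous_subspaceT => ?; exact: cvg_cst.
  by apply: integrableS icst => //; exact: subset_itv_oc_cc.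
- move=> s /= sab; apply: cmin; move: sab; rewrite !in_itv/= => /andP[/ltW -> ->] //.
Qed.

Lemma Gamma_gt0 b : -1 < b -> 0 < Gamma (b + 1).
Proof.
move=> b1; rewrite Gamma_wint.
have cw : cont_pos (fun s => weight b s * 1).
  by apply: cont_posM; [exact: cont_pos_weight|case: (pgrow_cst (1 : R))].
have w0 s : 0 < s -> 0 < weight b s * 1 by move=> s0; rewrite mulr1 weight_gt0.
apply: (lt_le_trans (@Rintegral_itv_gt0 _ 1 2 ltr01 ltac:(lra) cw w0)).
apply: Rintegral_subset_le => //.
- by move=> s; rewrite in_half_line /= in_itv/= => /andP[s1 _]; exact: lt_trans s1.
- by apply: integrable_weight => //; exact: pgrow_cst.
- by move=> s s0; rewrite ltW// w0.
Qed.

Lemma cvg_inv_succ_at_right : (k.+1%:R^-1 : R) @[k --> \oo] --> (0 : R)^'+.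
Proof.
move=> A HA.
have H : \forall k \near \oo, 0 < (k.+1%:R^-1 : R) -> A (k.+1%:R^-1).
  exact: (@cvg_harmonic R _ HA).
have : \forall k \near \oo, A (k.+1%:R^-1).
  by apply: filterS H => k; apply; rewrite invr_gt0.
exact.
Qed.

(** Against [weight b] the integrand is the derivative of [weight (b + 1) s * p.[s]], which vanishes
    at 0 because [b + 1 > 0] and at infinity by exponential decay. The recursion for Gamma and the
    orthogonality relations both rest on it. *)
Lemma wint_parts b p : -1 < b ->
  wint b (fun s => (b + 1 - s) * p.[s] + s * p^`().[s]) = 0.
Proof.
move=> b1.
have gP : pgrow (fun s => (b + 1 - s) * p.[s] + s * p^`().[s]).
  apply: pgrowD; apply: pgrowM; try exact: pgrow_horner; try exact: pgrow_id.
  by apply: pgrowB; [exact: pgrow_cst|exact: pgrow_id].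
pose F s := weight (b + 1) s * p.[s].
rewrite -(subrr 0); apply: (@Rintegral_FTC_half_line _ _ F).
- by apply: cont_posM; [exact: cont_pos_weight|case: gP].
- move=> s s0.
  have dp : is_derive s 1 (horner p) (p^`().[s]).
    by apply: DeriveDef; [exact: derivable_horner|rewrite -derive1E -derivE].
  apply: (is_derive_eq (is_deriveM (is_derive_weightS b s0) dp)).
  by rewrite /GRing.scale/= weightS//; ring.
- exact: integrable_weight.
- have cw : weight (b + 1) s @[s --> (0 : R)^'+] --> 0 * expR (- 0).
    apply: cvgM; first by apply: powR_cvg0; lra.
    apply: cvg_at_right_filter; apply: continuous_comp; first exact: continuousN.
    exact: continuous_expR.
  have c0 : F s @[s --> (0 : R)^'+] --> 0 * p.[0].
    apply: cvgM; first by rewrite mul0r in cw.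
    by apply: cvg_at_right_filter; exact: continuous_horner.
  rewrite mul0r in c0; exact: (cvg_comp _ _ cvg_inv_succ_at_right c0).
- have [_ [C [m [C0 pC]]]] := pgrow_horner p.
  (* The exponents account for the power in the weight, the growth of [p], and one spare factor
     [1 + s] that yields the decay. *)
  have [E E0 hE] := @expn_expR_bounded R (Num.bound `|b + 1| + m + 1).
  have Fb s : 0 < s -> `|F s| <= C * E / (1 + s).
    move=> s0; have s1 : 0 < 1 + s by lra.
    rewrite /F normrM ger0_norm ?weight_ge0//.
    rewrite ler_pdivlMr//.
    apply: (@le_trans _ _ (((1 + s) ^+ Num.bound `|b + 1| * expR (- s)) *
              (C * (1 + s) ^+ m) * (1 + s))).
      apply: ler_wpM2r; first exact: ltW.
      apply: ler_pM; [exact: weight_ge0|exact: normr_ge0| |exact: pC].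
      rewrite ler_wpM2r ?expR_ge0//.
      apply: le_trans (le_powR_expn (b + 1) (ltW s0)).
      by apply: ge0_ler_powR; rewrite ?nnegrE//; lra.
    have := hE s (ltW s0); rewrite !exprD expr1 => hE'.
    apply: le_trans (ler_wpM2l C0 hE'); rewrite le_eqVlt; apply/orP; left; apply/eqP.
    ring.
  apply/cvgr0Pnorm_lt => e e0.
  have : (C * E * (k.+1%:R^-1 : R)) @[k --> \oo] --> C * E * 0.
    by apply: cvgM; [exact: cvg_cst|exact: cvg_harmonic].
  rewrite mulr0 => /cvgr0Pnorm_lt /(_ e e0); apply: filterS => k.
  apply: le_lt_trans; have k0 : 0 < k.+1%:R :> R by [].
  apply: (le_trans (Fb _ k0)); apply: le_trans (ler_norm _).
  by rewrite ler_wpM2l ?mulr_ge0// lef_pV2 ?posrE//; lra.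
Qed.

Lemma GammaS b : -1 < b -> Gamma (b + 1 + 1) = (b + 1) * Gamma (b + 1).
Proof.
move=> b1; rewrite !Gamma_wint wint_shift.
have := wint_parts 1 b1.
rewrite (@eq_wint _ _ (fun s => (b + 1) * 1 - s * 1)); last first.
  by move=> s _; rewrite derivC !hornerE.
have gI : pgrow (fun s : R => s * 1).
  by apply: pgrowM; [exact: pgrow_id|exact: pgrow_cst].
rewrite (wintB b1 (pgrow_cst _) gI) (wintZ _ b1 (pgrow_cst _)); lra.
Qed.

(** The closed form of [h_n], and the inverse of the constant in [ell]; [lagp_orthogonal] identifies
    it as a squared norm. *)
Definition lagnorm n b : R := Gamma (n%:R + b + 1) / (n`!)%:R.

Lemma lagnorm_gt0 n b : -1 < b -> 0 < lagnorm n b.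
Proof.
move=> b1; rewrite divr_gt0 ?ltr0n ?fact_gt0//; apply: Gamma_gt0.
by rewrite (lt_le_trans b1)// lerDr.
Qed.

Lemma lagnorm_shiftS n b : lagnorm n (b + 1) = n.+1%:R * lagnorm n.+1 b.
Proof.
rewrite /lagnorm factS natrM -[n.+1%:R]natr1.
have := natf_neq0 (R := R) n; have : n.+1%:R != 0 :> R by rewrite pnatr_eq0.
rewrite -natr1 => h1 h2.
have -> : n%:R + (b + 1) + 1 = n%:R + 1 + b + 1 by ring.
by field; rewrite h1 h2.
Qed.

Lemma lagnorm_shift n b : -1 < b -> lagnorm n (b + 1) = (n%:R + b + 1) * lagnorm n b.
Proof.
move=> b1; rewrite /lagnorm addrA GammaS ?mulrA//.
by rewrite (lt_le_trans b1)// lerDr.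
Qed.

Lemma lagnormS n b : -1 < b ->
  n.+1%:R * lagnorm n.+1 b = (n%:R + b + 1) * lagnorm n b.
Proof. by move=> b1; rewrite -lagnorm_shiftS lagnorm_shift. Qed.

(** [wint_parts] for the product with [q]: Rodrigues' formula collects the terms in which [q] is not
    differentiated. The degree drops while the parameter rises, so orthogonality follows by
    induction on [n] for all parameters simultaneously. *)
Lemma wint_lagp_parts n b q : -1 < b ->
  wint b (fun s => (lagp n.+1 b).[s] * q.[s]) =
  - n.+1%:R^-1 * wint (b + 1) (fun s => (lagp n (b + 1)).[s] * q^`().[s]).
Proof.
move=> b1; have n0 : n.+1%:R != 0 :> R by rewrite pnatr_eq0.
have := wint_parts (lagp n (b + 1) * q) b1.
rewrite (@eq_wint _ _ (fun s => n.+1%:R * ((lagp n.+1 b).[s] * q.[s]) +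
   s * ((lagp n (b + 1)).[s] * q^`().[s]))); last first.
  move=> s _; have := congr1 (fun r => r.[s]) (lagp_rodrigues n b).
  rewrite derivM !hornerE => e; rewrite /= -e; ring.
have gq := pgrow_horner q; have gq' := pgrow_horner q^`().
have gl := pgrow_horner (lagp n.+1 b); have gl' := pgrow_horner (lagp n (b + 1)).
rewrite wintD ?wintZ//; last 3 first.
- exact: pgrowM.
- by apply: pgrowM; [exact: pgrow_cst|exact: pgrowM].
- by apply: pgrowM; [exact: pgrow_id|exact: pgrowM].
rewrite -wint_shift => /eqP; rewrite addr_eq0 => /eqP e.
by apply: (mulfI n0); rewrite e mulNr mulrN mulVKf.
Qed.

Lemma wint_eq0 b F : (forall s, 0 < s -> F s = 0) -> wint b F = 0.
Proof.
move=> F0; rewrite /wint /Rintegral integral0_eq// => s; rewrite in_half_line => /F0 ->.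
by rewrite mulr0.
Qed.

Lemma lagp_orthogonal n m b : -1 < b ->
  wint b (fun s => (lagp n b).[s] * (lagp m b).[s]) = (n == m)%:R * lagnorm n b.
Proof.
elim: n m b => [|n IH] [|m] b b1.
- rewrite eqxx mul1r /lagnorm fact0 divr1 add0r Gamma_wint.
  by apply: eq_wint => s _; rewrite lagp0 !hornerE.
- rewrite (@eq_wint _ _ (fun s => (lagp m.+1 b).[s] * (lagp 0 b).[s])); last first.
    by move=> s _; rewrite mulrC.
  rewrite wint_lagp_parts// lagp0 derivC mul0r wint_eq0 ?mulr0// => s _.
  by rewrite horner0 mulr0.
- rewrite wint_lagp_parts// lagp0 derivC mul0r wint_eq0 ?mulr0// => s _.
  by rewrite horner0 mulr0.
- rewrite wint_lagp_parts// deriv_lagp.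
  rewrite (@eq_wint _ _ (fun s => -1 * ((lagp n (b + 1)).[s] * (lagp m (b + 1)).[s]))).
    rewrite wintZ; [|lra|by apply: pgrowM; exact: pgrow_horner].
    rewrite IH; last lra.
    rewrite eqSS lagnorm_shiftS; case: eqP => [->|_]; last by rewrite !mul0r !mulr0.
    by rewrite !mul1r mulN1r mulrNN mulKf// pnatr_eq0.
  by move=> s _; rewrite hornerN; ring.
Qed.

Lemma laguerre_bessel b F K : -1 < b -> pgrow F ->
  \sum_(k < K) (wint b (fun s => (lagp k b).[s] * F s)) ^+ 2 / lagnorm k b <=
  wint b (fun s => F s ^+ 2).
Proof.
move=> b1 gF; pose v k := wint b (fun s => (lagp k b).[s] * F s).
pose a k := v k / lagnorm k b.
pose P K : {poly R} := \sum_(k < K) a k *: lagp k b.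
have gL k : pgrow (horner (lagp k b)) by exact: pgrow_horner.
have gr N : pgrow (fun s => F s - (P N).[s]) by apply: pgrowB => //; exact: pgrow_horner.
have PS N s : F s - (P N.+1).[s] = (F s - (P N).[s]) - a N * (lagp N b).[s].
  by rewrite /P big_ord_recr/= hornerD hornerZ opprD addrA.
have orth N j : (N <= j)%N ->
    wint b (fun s => (lagp j b).[s] * (F s - (P N).[s])) = v j.
  elim: N => [|N IH] Nj.
    by apply: eq_wint => s _; rewrite /P big_ord0 horner0 subr0.
  rewrite -IH ?(ltnW Nj)//.
  rewrite (@eq_wint _ _ (fun s => (lagp j b).[s] * (F s - (P N).[s]) -
     a N * ((lagp j b).[s] * (lagp N b).[s]))); last first.
    by move=> s _; rewrite PS; ring.
  rewrite wintB ?wintZ ?lagp_orthogonal//.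
  - by rewrite gtn_eqF// mul0r mulr0 subr0.
  - exact: pgrowM.
  - exact: pgrowM.
  - by apply: pgrowM; [exact: pgrow_cst|exact: pgrowM].
(* Bessel's identity for the residual; since the left side is nonnegative, the inequality
   follows. *)
suff E N : wint b (fun s => (F s - (P N).[s]) ^+ 2) =
    wint b (fun s => F s ^+ 2) - \sum_(k < N) v k ^+ 2 / lagnorm k b.
  rewrite -subr_ge0 -E; apply: wint_ge0 => s _; exact: sqr_ge0.
elim: N => [|N IH].
  rewrite big_ord0 subr0; apply: eq_wint => s _.
  by rewrite /P big_ord0 horner0 subr0.
have h0 := lagnorm_gt0 N b1.
rewrite (@eq_wint _ _ (fun s => (F s - (P N).[s]) * (F s - (P N).[s]) -
   ((2 * a N) * ((lagp N b).[s] * (F s - (P N).[s])) -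
     a N ^+ 2 * ((lagp N b).[s] * (lagp N b).[s])))); last first.
  by move=> s _; rewrite PS; ring.
have g1 : pgrow (fun s => (F s - (P N).[s]) * (F s - (P N).[s])) by exact: pgrowM.
have g2 : pgrow (fun s => (lagp N b).[s] * (F s - (P N).[s])) by exact: pgrowM.
have g3 : pgrow (fun s => (lagp N b).[s] * (lagp N b).[s]) by exact: pgrowM.
have g4 c : pgrow (fun s => c * ((lagp N b).[s] * (F s - (P N).[s]))).
  by apply: pgrowM => //; exact: pgrow_cst.
have g5 c : pgrow (fun s => c * ((lagp N b).[s] * (lagp N b).[s])).
  by apply: pgrowM => //; exact: pgrow_cst.
rewrite wintB//; last exact: pgrowB.
rewrite wintB// !wintZ// lagp_orthogonal// orth// eqxx.
rewrite [X in X - _](_ : _ = wint b (fun s => (F s - (P N).[s]) ^+ 2))//.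
rewrite IH big_ord_recr/= /a.
by field; rewrite gt_eqF.
Qed.

(** By [lagpS] and [lagp_mulX], [x L^(b+1)(x)] is a combination of [L_N^(b)(x)] and
    [L_(N+1)^(b)(x)]. The induction step is then a rational identity in their values at [t] and
    [s]. *)
Lemma laguerre_christoffel_darboux N b t s : -1 < b ->
  (t - s) * \sum_(n < N.+1) (lagp n b).[t] * (lagp n b).[s] / lagnorm n b =
  (t * (lagp N (b + 1)).[t] * (lagp N b).[s] -
   s * (lagp N (b + 1)).[s] * (lagp N b).[t]) / lagnorm N b.
Proof.
move=> b1; elim: N => [|N IH].
  by rewrite big_ord_recr big_ord0/= !lagp0 !hornerE /= !mulr1.
rewrite big_ord_recr/= mulrDr IH.
have e1 x : x * (lagp N (b + 1)).[x] =
    (N%:R + b + 1) * (lagp N b).[x] - N.+1%:R * (lagp N.+1 b).[x].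
  by have := congr1 (fun r => r.[x]) (lagp_mulX N b); rewrite !hornerE.
have e2 x : x * (lagp N.+1 (b + 1)).[x] = x * (lagp N.+1 b).[x] + x * (lagp N (b + 1)).[x].
  by rewrite lagpS hornerD mulrDr.
have h0 := lagnorm_gt0 N b1; have h1 := lagnorm_gt0 N.+1 b1.
have n0 : N.+1%:R != 0 :> R by rewrite pnatr_eq0.
have A0 : N%:R + b + 1 != 0.
  by rewrite gt_eqF// (@lt_le_trans _ _ (b + 1)) ?lerD2r ?lerDr//; lra.
have hE : lagnorm N b = N.+1%:R * lagnorm N.+1 b / (N%:R + b + 1).
  by rewrite lagnormS// mulrAC mulfV// mul1r.
rewrite hE !e2 !e1; move: (N.+1%:R) (N%:R + b + 1) n0 A0 => c A n0 A0.
by field; rewrite A0 n0 gt_eqF.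
Qed.

End laguerre_orthogonality.

(** * Bounds for Laguerre polynomials *)

Section laguerre_bounds.
Context {R : realType}.
Local Notation mu := (@lebesgue_measure R).
Local Notation D := [set` `]0%R, +oo[ : interval R].
Implicit Types (a b s t : R) (F : R -> R).

(** One step of the discrete Sobolev inequality. Passing from [k] to [k + 1] costs the product of
    [v] and the weighted increment, split by AM-GM with parameter [r]; the condition on [r] lets
    [v ^ 2 / r] be absorbed. The term in [|b|] pays for the difference between [k + 1] and
    [k + b + 1]. *)
Let resolvent_step b (k : nat) (v v' r : R) : -1 < b -> 0 < r -> r <= 1 ->
  r^-1 <= r * (k%:R + b + 1) ->
  v ^+ 2 / lagnorm k b <= v' ^+ 2 / lagnorm k.+1 b +
   r * (`|b| * (v' ^+ 2 / lagnorm k.+1 b) +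
    ((k%:R + b + 1) * v - k.+1%:R * v') ^+ 2 / lagnorm k (b + 1) +
     v ^+ 2 / lagnorm k b).
Proof.
move=> b1 r0 r1; have h0 := lagnorm_gt0 k b1.
rewrite lagnorm_shift//; set A := k%:R + b + 1 => rA.
have A0 : 0 < A.
  by rewrite -(pmulr_rgt0 _ r0); apply: lt_le_trans rA; rewrite invr_gt0.
have k1 : 0 < k.+1%:R :> R by [].
have hS : lagnorm k.+1 b = A * lagnorm k b / k.+1%:R.
  by rewrite -lagnormS// mulrC mulKf// gt_eqF.
have -> : v' ^+ 2 / lagnorm k.+1 b = k.+1%:R * v' ^+ 2 / (A * lagnorm k b).
  rewrite hS; move: (k.+1%:R) k1 => c k1.
  by field; rewrite !gt_eqF.
have kA : k.+1%:R = A - b by rewrite /A -natr1; ring.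
have Ah : 0 < A * lagnorm k b by exact: mulr_gt0.
rewrite kA -(ler_pM2r Ah).
have -> : v ^+ 2 / lagnorm k b * (A * lagnorm k b) = A * v ^+ 2.
  by field; rewrite gt_eqF.
set u := (A - b) * v' ^+ 2; set e := A * v - (A - b) * v'.
have -> : (u / (A * lagnorm k b) + r * (`|b| * (u / (A * lagnorm k b)) +
    e ^+ 2 / (A * lagnorm k b) + v ^+ 2 / lagnorm k b)) * (A * lagnorm k b)
  = u + r * (`|b| * u + e ^+ 2 + A * v ^+ 2).
  by field; rewrite !gt_eqF.
have u0 : 0 <= u by rewrite /u -kA mulr_ge0// sqr_ge0.
(* Completing the square: the two sides differ by [e ^ 2 / A]. *)
have e1 : A * v ^+ 2 <= (1 - b / A) * u + 2 * e * v.
  rewrite -(@ler_pM2l _ A)//.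
  have -> : A * ((1 - b / A) * u + 2 * e * v) = (A - b) * u + 2 * A * e * v.
    by field; rewrite gt_eqF.
  rewrite -subr_ge0.
  have -> : (A - b) * u + 2 * A * e * v - A * (A * v ^+ 2) = e ^+ 2.
    by rewrite /u /e; ring.
  exact: sqr_ge0.
have e2 : - (b / A) * u <= r * (`|b| * u).
  rewrite [leRHS]mulrA ler_wpM2r//.
  apply: (@le_trans _ _ (`|b| / A)).
    rewrite -mulNr; apply: ler_wpM2r; first by rewrite invr_ge0 ltW.
    by rewrite -normrN ler_norm.
  rewrite mulrC ler_wpM2r//.
  rewrite -[leRHS]invrK lef_pV2 ?posrE ?invr_gt0//.
  by apply: (le_trans rA); apply: ler_piMl => //; exact: ltW.
have e3 : 2 * e * v <= r * (e ^+ 2 + A * v ^+ 2).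
  apply: (@le_trans _ _ (r * e ^+ 2 + r^-1 * v ^+ 2)).
    rewrite -subr_ge0.
    have -> : r * e ^+ 2 + r^-1 * v ^+ 2 - 2 * e * v = r^-1 * (r * e - v) ^+ 2.
      by field; rewrite gt_eqF.
    by rewrite mulr_ge0 ?invr_ge0 ?sqr_ge0// ltW.
  by rewrite mulrDr lerD2l mulrA ler_wpM2r ?sqr_ge0.
lra.
Qed.

(* With [F = L_n / (1 + s)] and [v_k = <L_k, F>], Bessel's inequality for the
   systems of parameters [b] and [b + 1] bounds both the sum of the
   [v_k ^ 2 / |L_k| ^ 2] and the weighted sum of their squared increments by
   [v_n]; a discrete Sobolev inequality then gives
   [v_n ^ 2 / |L_n| ^ 2 <= C v_n / sqrt n]. *)
Lemma laguerre_resolvent_bound b n : -1 < b -> (0 < n)%N ->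
  wint b (fun s => (lagp n b).[s] ^+ 2 * (1 + s)^-1) <=
  (3 + `|b|) * (lagnorm n b / Num.sqrt n%:R).
Proof.
move=> b1 n0; set G := wint b _.
have b2 : -1 < b + 1 by lra.
pose F s := (lagp n b).[s] * (1 + s)^-1.
have gL m c : pgrow (horner (lagp m c)) by exact: pgrow_horner.
have gF : pgrow F by apply: pgrowM => //; exact: pgrow_inv1D.
have gF2 : pgrow (fun s => F s ^+ 2) by apply: pgrowM.
have gG : pgrow (fun s => (lagp n b).[s] ^+ 2 * (1 + s)^-1).
  by apply: pgrowM; [exact: pgrowM|exact: pgrow_inv1D].
pose v k := wint b (fun s => (lagp k b).[s] * F s).
pose z k := v k ^+ 2 / lagnorm k b.
pose d k := ((k%:R + b + 1) * v k - k.+1%:R * v k.+1) ^+ 2 / lagnorm k (b + 1).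
have z0 k : 0 <= z k by rewrite divr_ge0 ?sqr_ge0// ltW// lagnorm_gt0.
have d0 k : 0 <= d k by rewrite divr_ge0 ?sqr_ge0// ltW// lagnorm_gt0.
have vn : v n = G by apply: eq_wint => s _; rewrite /F mulrA -expr2.
have F2E s : 0 < s -> F s ^+ 2 = (lagp n b).[s] ^+ 2 * (1 + s)^-1 * (1 + s)^-1.
  by move=> s0; rewrite /F exprMn expr2 mulrA -expr2.
have G0 : 0 <= G.
  by apply: wint_ge0 => s s0; rewrite mulr_ge0 ?sqr_ge0// invr_ge0; lra.
have Bz K : \sum_(k < K) z k <= G.
  apply: (le_trans (laguerre_bessel K b1 gF)); apply: le_wint => // s s0.
  rewrite F2E// ler_piMr//; first by rewrite mulr_ge0 ?sqr_ge0// invr_ge0; lra.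
  by rewrite invf_le1; lra.
(* By [lagp_mulX] the coefficients of [F] for the parameter [b + 1] are exactly the increments in
   [d]. The factor [s] from the larger weight is absorbed by the second [1 / (1 + s)] in [F ^ 2]. *)
have Bd K : \sum_(k < K) d k <= G.
  have := laguerre_bessel K b2 gF.
  rewrite (eq_bigr (fun k : 'I_K => d k)); last first.
    move=> k _; rewrite /d; congr (_ ^+ 2 / _).
    rewrite wint_shift /v -!wintZ//; try exact: pgrowM.
    rewrite -wintB//; try by apply: pgrowM; [exact: pgrow_cst|exact: pgrowM].
    apply: eq_wint => s _.
    have := congr1 (fun r => r.[s]) (lagp_mulX k b); rewrite !hornerE /= => e.
    by rewrite e; ring.
  move=> /le_trans; apply; rewrite wint_shift; apply: le_wint => //.
    by apply: pgrowM => //; exact: pgrow_id.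
  move=> s s0; rewrite F2E// mulrCA ler_piMr//.
    by rewrite mulr_ge0 ?sqr_ge0// invr_ge0; lra.
  by rewrite ler_pdivrMr; lra.
(* This satisfies the condition of [resolvent_step] at every index from [n] on, because
   [b + 1 > 0]. *)
pose r : R := (Num.sqrt n%:R)^-1.
have nR : 1 <= n%:R :> R by rewrite ler1n.
have sq0 : 0 < Num.sqrt n%:R :> R by rewrite sqrtr_gt0; lra.
have r0 : 0 < r by rewrite invr_gt0.
have r1 : r <= 1.
  by rewrite invf_le1// -[leLHS]sqrtr1 ler_wsqrtr.
have rn : r * n%:R = r^-1.
  by rewrite /r invrK -{2}(@sqr_sqrtr _ n%:R)// expr2 mulKf// gt_eqF.
have tail (x : nat -> R) j m : (forall k, 0 <= x k) -> (forall K, \sum_(k < K) x k <= G) ->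
    \sum_(i < j) x (m + i)%N <= G.
  move=> x0 Bx; apply: le_trans (Bx (m + j)%N); rewrite big_split_ord/=.
  by rewrite lerDr sumr_ge0.
have tele j : z n <= z (n + j)%N + r * (`|b| * \sum_(i < j) z (n.+1 + i)%N +
     \sum_(i < j) d (n + i)%N + \sum_(i < j) z (n + i)%N).
  elim: j => [|j IH]; first by rewrite !big_ord0 addn0 !addr0 !mulr0 addr0.
  have rA : r^-1 <= r * ((n + j)%:R + b + 1).
    rewrite -rn ler_pM2l// natrD; have := ler0n R j; lra.
  have := @resolvent_step b (n + j) (v (n + j)%N) (v (n + j).+1) r b1 r0 r1 rA.
  rewrite -/(z (n + j)%N) -/(z (n + j).+1) -/(d (n + j)%N).
  rewrite !big_ord_recr/= addnS addSn; nra.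
have zj j : z n <= z (n + j)%N + r * ((`|b| + 2) * G).
  apply: (le_trans (tele j)); rewrite lerD2l ler_pM2l//.
  have t1 := tail z j n.+1 z0 Bz; have t2 := tail d j n d0 Bd; have t3 := tail z j n z0 Bz.
  have := ler_wpM2l (normr_ge0 b) t1; lra.
(* Average over the block of indices from [n] to [2 n - 1], on which the sum of [z] is at most [G].
   The resulting term [G / n] is at most [r G], whence the constant [1 + (2 + |b|)]. *)
have avg : n%:R * z n <= G + n%:R * (r * ((`|b| + 2) * G)).
  have -> : n%:R * z n = \sum_(j < n) z n.
    by rewrite sumr_const card_ord mulr_natl.
  apply: (@le_trans _ _ (\sum_(j < n) (z (n + j)%N + r * ((`|b| + 2) * G)))).
    by apply: ler_sum => j _; exact: zj.
  rewrite big_split/= sumr_const card_ord mulr_natl lerD2r.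
  exact: tail.
have zn : z n <= (3 + `|b|) * r * G.
  rewrite -(@ler_pM2l _ n%:R) ?ltr0n//; apply: (le_trans avg).
  have nr : 1 <= n%:R * r by rewrite mulrC rn -[leLHS]invr1 lef_pV2 ?posrE.
  have := ler_wpM2r G0 nr; lra.
have hn := lagnorm_gt0 n b1.
move: zn; rewrite /z vn ler_pdivrMr// => zn.
(* Here [z n] is [G ^ 2 / lagnorm n b], so one factor [G] cancels unless [G = 0]. *)
move: G0; rewrite le_eqVlt => /predU1P[<-|G0].
  by rewrite mulr_ge0 ?addr_ge0// divr_ge0// ltW.
rewrite -(ler_pM2r G0) -expr2 (le_trans zn)// le_eqVlt; apply/orP; left; apply/eqP.
by rewrite /r; ring.
Qed.

Lemma sqrt_half_bound (m : nat) : (0 < m)%N ->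
  (Num.sqrt m%:R)^-1 <= 2 * (Num.sqrt m.+1%:R)^-1 :> R.
Proof.
move=> m0.
have sm0 : 0 < Num.sqrt m%:R :> R by rewrite sqrtr_gt0 ltr0n.
have sn0 : 0 < Num.sqrt m.+1%:R :> R by rewrite sqrtr_gt0.
rewrite ler_pdivlMr// mulrC ler_pdivrMr//.
rewrite -(@ler_pXn2r _ 2) ?nnegrE ?mulr_ge0 ?sqrtr_ge0// exprMn !sqr_sqrtr//.
have : 1 <= m%:R :> R by rewrite ler1n.
by rewrite -natr1; lra.
Qed.

(** This is [n y ^ 2 + s y' ^ 2] for [y = L_n^(b)], with [n = m + 1] and [y' = - L_m^(b+1)]
    substituted. *)
Let energy m b : {poly R} :=
  m.+1%:R *: (lagp m.+1 b) ^+ 2 + 'X * (lagp m (b + 1)) ^+ 2.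

(** Rodrigues' formula serves as the Laguerre equation [s y'' + (b + 1 - s) y' + n y = 0]. The terms
    in [y y'] cancel, so no factor [n] survives and the growth rate is uniform in [n]. *)
Let deriv_energy m b s :
  (energy m b)^`().[s] = (2 * s - 2 * b - 1) * (lagp m (b + 1)).[s] ^+ 2.
Proof.
set l := lagp m (b + 1); set y := lagp m.+1 b; set n : R := m.+1%:R.
have e : s * l^`().[s] = n * y.[s] - (b + 1 - s) * l.[s].
  have := congr1 (fun r => r.[s]) (lagp_rodrigues m b); rewrite !hornerE /=.
  by rewrite -/l -/y -/n => <-; ring.
have -> : (energy m b)^`().[s] = - 2 * l.[s] * (n * y.[s]) + l.[s] ^+ 2 +
    2 * l.[s] * (s * l^`().[s]).
  rewrite /energy -/l -/y -/n derivD derivZ derivM derivX !deriv_exp deriv_lagp -/l.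
  by rewrite !hornerE /=; ring.
by rewrite e; ring.
Qed.

Let energyE m b s : (energy m b).[s] =
  m.+1%:R * (lagp m.+1 b).[s] ^+ 2 + s * (lagp m (b + 1)).[s] ^+ 2.
Proof. by rewrite /energy !hornerE /=; ring. Qed.

Let energy_ge m b s : 0 < s -> s * (lagp m (b + 1)).[s] ^+ 2 <= (energy m b).[s].
Proof.
by move=> s0; rewrite energyE lerDr mulr_ge0 ?sqr_ge0.
Qed.

(** To the right of [t] the derivative of the energy is at least [- |2 b + 1| y' ^ 2], hence at
    least [- c] times the energy, because [s >= t]. So [exp (c s)] times the energy is
    nondecreasing, and the interval has length 1. *)
Let energy_growth m b t s : 0 < t -> t <= s -> s <= t + 1 ->
  (energy m b).[t] <= expR (`|2 * b + 1| / t) * (energy m b).[s].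
Proof.
move=> t0 ts st; set c : R := `|2 * b + 1| / t.
have c0 : 0 <= c by rewrite divr_ge0// ltW.
pose P (x : R) : R := expR (c * x) * (energy m b).[x].
pose P' (x : R) : R := expR (c * x) * (c * (energy m b).[x] + (energy m b)^`().[x]).
have dP (x : R) : is_derive x 1 P (P' x).
  have d1 : is_derive x 1 (fun u : R => expR (c * u)) (expR (c * x) * c).
    apply: (is_derive1_comp (is_derive_expR (c * x))).
    apply: (is_derive_eq (is_deriveM (is_derive_cst c x 1) (is_derive_id x 1))).
    by rewrite scaler0 addr0 /GRing.scale/= mulr1.
  have d2 : is_derive x 1 (horner (energy m b)) ((energy m b)^`().[x]).
    by apply: DeriveDef; [exact: derivable_horner|rewrite -derive1E -derivE].
  apply: (is_derive_eq (is_deriveM d1 d2)); rewrite /GRing.scale/= /P'; ring.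
have cP : {within `[t, s], continuous P}.
  apply: continuous_subspaceT => x.
  have [d _] := dP x; exact/differentiable_continuous/derivable1_diffP.
have [y + e] := MVT_segment ts (fun x _ => dP x) cP.
rewrite in_itv/= => /andP[ty _].
have y0 : 0 < y by exact: lt_le_trans ty.
have P'0 : 0 <= P' y.
  rewrite mulr_ge0 ?expR_ge0// deriv_energy.
  have h1 := ler_wpM2l c0 (@energy_ge m b y y0).
  have cy : `|2 * b + 1| <= c * y.
    by rewrite /c mulrAC ler_pdivlMr// ler_wpM2l.
  have := ler_wpM2r (sqr_ge0 (lagp m (b + 1)).[y]) cy.
  have := ler_wpM2r (sqr_ge0 (lagp m (b + 1)).[y]) (ler_norm (2 * b + 1)).
  have := mulr_ge0 (ltW y0) (sqr_ge0 (lagp m (b + 1)).[y]).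
  set q := (lagp m (b + 1)).[y] ^+ 2 in h1 *; lra.
have Pts : P t <= P s by rewrite -subr_ge0 e mulr_ge0// subr_ge0.
have E0 : 0 <= (energy m b).[s].
  apply: le_trans (@energy_ge m b s (lt_le_trans t0 ts)).
  by rewrite mulr_ge0 ?sqr_ge0// ltW// (lt_le_trans t0 ts).
rewrite -(ler_pM2l (expR_gt0 (c * t))); apply: (le_trans Pts).
rewrite /P mulrA -expRD ler_wpM2r// ler_expR.
by have := ler_wpM2l c0 st; lra.
Qed.

(** The energy at [t] is compared with its average over []t, t + 1]] against [weight b s / (1 + s)].
    The resolvent bound for [b] controls the part in [y ^ 2], and the one for [b + 1] the part in
    [s y' ^ 2]; both are of order [n h_n / sqrt n]. *)
Lemma laguerre_pointwise_bound b t : -1 < b -> 0 < t ->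
  exists2 C : R, 0 <= C & forall n, (1 < n)%N ->
    (lagp n b).[t] ^+ 2 <= C * (lagnorm n b / Num.sqrt n%:R).
Proof.
move=> b1 t0; have b2 : -1 < b + 1 by lra.
pose rho s := weight b s * (1 + s)^-1.
have crho : cont_pos rho.
  by apply: cont_posM; [exact: cont_pos_weight|case: (@pgrow_inv1D R)].
have rho0 s : 0 < s -> 0 < rho s.
  by move=> s0; rewrite mulr_gt0 ?weight_gt0// invr_gt0; lra.
have tt : t < t + 1 by rewrite ltrDl.
pose m0 := Rintegral mu `]t, t + 1] rho.
have m00 : 0 < m0 by exact: Rintegral_itv_gt0.
pose X := expR (`|2 * b + 1| / t).
(* The factor 2 comes from [sqrt_half_bound]: the derivative has degree [m = n - 1], so its estimate
   carries [sqrt m]. Division by [m0] undoes the averaging. *)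
exists (X * ((3 + `|b|) + 2 * (3 + `|b + 1|)) / m0).
  apply: divr_ge0; last exact: ltW.
  apply: mulr_ge0; first exact: expR_ge0.
  by have := normr_ge0 b; have := normr_ge0 (b + 1); lra.
move=> [|m]// m1; have {}m1 : (0 < m)%N by rewrite -ltnS.
set n : R := m.+1%:R; have n0 : 0 < n by [].
set h := lagnorm m.+1 b; have h0 : 0 < h by exact: lagnorm_gt0.
have gE : pgrow (fun s => (energy m b).[s] * (1 + s)^-1).
  by apply: pgrowM; [exact: pgrow_horner|exact: pgrow_inv1D].
have iE := integrable_weight b1 gE.
have sub : `]t, (t + 1)] `<=` D.
  by move=> s; rewrite in_half_line /= in_itv/= => /andP[ts _]; exact: lt_trans ts.
have irho : mu.-integrable D (EFin \o rho).
  exact: (integrable_weight b1 (@pgrow_inv1D R)).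
have le1 : (energy m b).[t] * m0 <= X * wint b (fun s => (energy m b).[s] * (1 + s)^-1).
  apply: (@le_trans _ _ (X * Rintegral mu `]t, (t + 1)]
     (fun s => weight b s * ((energy m b).[s] * (1 + s)^-1)))); last first.
    rewrite ler_wpM2l ?expR_ge0//; apply: Rintegral_subset_le => // s s0.
    rewrite mulr_ge0 ?weight_ge0// mulr_ge0//; last by rewrite invr_ge0; lra.
    apply: le_trans (@energy_ge m b s s0).
    by rewrite mulr_ge0 ?sqr_ge0// ltW.
  have i1 : mu.-integrable `]t, (t + 1)] (EFin \o rho) by apply: integrableS irho.
  have i2 : mu.-integrable `]t, (t + 1)]
     (EFin \o (fun s => weight b s * ((energy m b).[s] * (1 + s)^-1))).
    by apply: integrableS iE.
  rewrite -!RintegralZl//; apply: le_Rintegral => //.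
  - apply: (@integrableS _ _ _ mu D) => //; exact: integrableRZ.
  - apply: (@integrableS _ _ _ mu D) => //; exact: integrableRZ.
  - move=> s; rewrite /= in_itv/= => /andP[ts st].
    have s0 : 0 < s by exact: lt_trans ts.
    rewrite /rho [leRHS]mulrCA [leLHS]mulrCA ler_wpM2l ?weight_ge0//.
    rewrite [leRHS]mulrA; apply: ler_wpM2r; first by rewrite invr_ge0; lra.
    exact: energy_growth t0 (ltW ts) st.
have gl k c : pgrow (fun s : R => (lagp k c).[s] ^+ 2 * (1 + s)^-1).
  apply: pgrowM; last exact: pgrow_inv1D.
  by apply: pgrowM; exact: pgrow_horner.
have le2 : wint b (fun s => (energy m b).[s] * (1 + s)^-1) <=
    n * ((3 + `|b|) * (h / Num.sqrt n)) +
    (3 + `|b + 1|) * (n * h / Num.sqrt m%:R).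
  rewrite (@eq_wint _ _ _ (fun s => n * ((lagp m.+1 b).[s] ^+ 2 * (1 + s)^-1) +
     s * ((lagp m (b + 1)).[s] ^+ 2 * (1 + s)^-1))); last first.
    by move=> s s0; rewrite energyE -/n; ring.
  rewrite wintD//; last 2 first.
  - by apply: pgrowM => //; exact: pgrow_cst.
  - by apply: pgrowM => //; exact: pgrow_id.
  rewrite wintZ// -wint_shift; apply: lerD.
    by rewrite ler_pM2l//; exact: laguerre_resolvent_bound.
  by have := laguerre_resolvent_bound b2 m1; rewrite lagnorm_shiftS.
have sn0 : 0 < Num.sqrt n :> R by rewrite sqrtr_gt0.
have sqle := sqrt_half_bound m1; rewrite -/n in sqle.
have yE : n * (lagp m.+1 b).[t] ^+ 2 <= (energy m b).[t].
  by rewrite energyE lerDl mulr_ge0 ?sqr_ge0// ltW.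
rewrite -(ler_pM2l n0) -(ler_pM2r m00).
apply: (le_trans (ler_wpM2r (ltW m00) yE)); apply: (le_trans le1).
have -> : n * (X * (3 + `|b| + 2 * (3 + `|b + 1|)) / m0 * (h / Num.sqrt n)) * m0 =
  X * (n * ((3 + `|b|) * (h / Num.sqrt n)) + (3 + `|b + 1|) * (n * h * (2 * (Num.sqrt n)^-1))).
  by field; rewrite !gt_eqF.
rewrite ler_wpM2l ?expR_ge0//; apply: (le_trans le2); rewrite lerD2l.
rewrite ler_wpM2l ?addr_ge0// ler_wpM2l// mulr_ge0// ltW//.
Qed.

End laguerre_bounds.

(** * The Bochner integral *)

Section cutoff.
Context {R : realType}.
Local Notation mu := (@lebesgue_measure R).
Local Notation D := [set` `]0%R, +oo[ : interval R].
Implicit Types (A : set R) (h : R -> R).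

Lemma integrable_indicM A h : measurable A -> mu.-integrable D (EFin \o h) ->
  mu.-integrable D (EFin \o (fun s => \1_A s * h s)).
Proof.
move=> mA ih; apply: (@integrable_le _ _ (fun s => `|h s|)).
- apply: measurable_funM.
    exact: measurable_indic.
  by apply/measurable_EFinP; exact: measurable_int ih.
- exact: (integrable_norm ih).
- move=> s _; rewrite normrM ler_piMl// indicE.
  by case: (s \in A); rewrite ?normr1 ?normr0.
Qed.

Lemma Rintegral_indicM A h : A `<=` D ->
  Rintegral mu D (fun s => \1_A s * h s) = Rintegral mu A h.
Proof.
move=> AD; have {2}-> : A = D `&` A by rewrite (setIidr AD).
rewrite Rintegral_mkcondr; apply: eq_Rintegral => s _.
by rewrite patchE indicE; case: ifPn => _; rewrite ?mul1r ?mul0r.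
Qed.

Lemma integrable_indic_pos A : measurable A -> A `<=` D -> (mu A < +oo)%E ->
  mu.-integrable D (EFin \o (\1_A : R -> R)) /\
  Rintegral mu D (\1_A : R -> R) = fine (mu A).
Proof.
move=> mA AD Afin.
have e : (\int[mu]_(s in D) (\1_A s)%:E)%E = mu A.
  by rewrite integral_indic// (setIidl AD).
split; last by rewrite /Rintegral e.
by apply: integrable_pos_fin => //; rewrite e.
Qed.

End cutoff.

Section bochner.
Context {R : realType}.
Local Notation mu := (@lebesgue_measure R).
Local Notation D := [set` `]0%R, +oo[ : interval R].

(** * Testing Bochner integrals against functionals *)

Section functional.
Context {X : normedModType R}.
Implicit Types (g : R -> X).

Definition dual_ball (phi : X -> R) :=
  [/\ forall x, `|phi x| <= `|x|, forall x y, phi (x + y) = phi x + phi y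
    & forall (a : R) x, phi (a *: x) = a * phi x].

Lemma dual_ball_le phi x : dual_ball phi -> `|phi x| <= `|x|.
Proof. by case. Qed.

Lemma dual_ball0 phi : dual_ball phi -> phi 0 = 0.
Proof. by case=> _ _ pZ; rewrite -(scale0r 0) pZ mul0r. Qed.

Lemma dual_ballB phi x y : dual_ball phi -> phi (x - y) = phi x - phi y.
Proof. by case=> _ pD pZ; rewrite pD -scaleN1r pZ mulN1r. Qed.

Lemma dual_ball_continuous phi g : dual_ball phi -> cont_pos g -> cont_pos (phi \o g).
Proof.
move=> dphi cg s s0; apply/cvgrPdist_lt => e e0 /=.
have /cvgrPdist_lt/(_ e e0) := cg s s0; apply: filterS => u.
by apply: le_lt_trans; rewrite -dual_ballB//; exact: dual_ball_le.
Qed.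

Lemma cont_pos_norm g : cont_pos g -> cont_pos (fun s => `|g s|).
Proof. by move=> cg s s0; apply: cvg_norm; exact: cg. Qed.

Definition finite_simple (s : seq (set R * X)) := forall p, p \in s ->
  [/\ measurable p.1, p.1 `<=` D & (mu p.1 < +oo)%E].

Lemma simple_fun_cons p (s : seq (set R * X)) t :
  simple_fun (p :: s) t = (\1_(p.1) t : R) *: p.2 + simple_fun s t.
Proof. by rewrite /simple_fun big_cons. Qed.

Lemma dual_ball_simple phi (s : seq (set R * X)) : dual_ball phi -> finite_simple s ->
  mu.-integrable D (EFin \o (phi \o simple_fun s)) /\
  Rintegral mu D (phi \o simple_fun s) = phi (simple_int mu s).
Proof.
move=> dphi; have [pn pD pZ] := dphi; elim: s => [|p s IH] sfin.
  have e : phi \o simple_fun [::] = cst 0 :> (R -> R).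
    by apply/funext => t; rewrite /= /simple_fun big_nil (dual_ball0 dphi).
  rewrite e /simple_int big_nil (dual_ball0 dphi); split; first exact: integrable0.
  by rewrite /Rintegral integral0_eq.
have [mp pD' pfin] := sfin p (mem_head _ _).
have sfin' : finite_simple s by move=> q qs; apply: sfin; rewrite inE qs orbT.
have [is' es] := IH sfin'.
have [i1 e1] := integrable_indic_pos mp pD' pfin.
have e : phi \o simple_fun (p :: s) =
    (fun t => phi p.2 * \1_(p.1) t + (phi \o simple_fun s) t) :> (R -> R).
  by apply/funext => t; rewrite /= simple_fun_cons pD pZ mulrC.
rewrite e; split; first by apply: integrableRD => //; exact: integrableRZ.
rewrite RintegralD//; last exact: integrableRZ.
by rewrite RintegralZl// es e1 /simple_int big_cons pD pZ mulrC.
Qed.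

Lemma integrable_dual_ball phi g : dual_ball phi -> cont_pos g ->
  mu.-integrable D (EFin \o (fun s => `|g s|)) ->
  mu.-integrable D (EFin \o (phi \o g)).
Proof.
move=> dphi cg ig; apply: integrable_le ig _.
  by apply: cont_pos_measurable; exact: dual_ball_continuous.
by move=> s _; exact: dual_ball_le.
Qed.

(** On simple functions the functional commutes with the integral exactly. The bound is independent
    of [phi], so norming functionals convert it into norm estimates in [X]. *)
Lemma simple_int_dist phi g (s : seq (set R * X)) :
  dual_ball phi -> finite_simple s -> cont_pos g ->
  mu.-integrable D (EFin \o (fun s => `|g s|)) ->
  (`|phi (simple_int mu s) - Rintegral mu D (phi \o g)|%:E <=
   \int[mu]_(t in D) `|simple_fun s t - g t|%:E)%E.
Proof.
move=> dphi sfin cg ig; have [is' es] := dual_ball_simple dphi sfin.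
have ipg := integrable_dual_ball dphi cg ig.
rewrite -es -RintegralB// EFin_normr_Rintegral//; last exact: integrableRB.
apply: le_trans (le_abse_integral _ _ _) _ => //.
  by apply: measurable_int; exact: (integrableRB is' ipg).
apply: ge0_le_lower_integral => t _; first by rewrite abse_ge0.
by rewrite /= lee_fin -dual_ballB//; exact: dual_ball_le.
Qed.

(** Pins down every witness [c] through scalar integrals; the expansion, which concerns arbitrary
    families of witnesses, uses them only in this way. *)
Lemma bochner_integral_dual g c phi : dual_ball phi -> cont_pos g ->
  mu.-integrable D (EFin \o (fun s => `|g s|)) ->
  bochner_integral mu D g c -> phi c = Rintegral mu D (phi \o g).
Proof.
move=> dphi cg ig [s [sfin _ sL1 sc]].
apply/eqP; rewrite -subr_eq0 -normr_le0; apply/ler_addgt0Pr => e e0; rewrite add0r.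
have e20 : 0 < e / 2 by rewrite divr_gt0.
move/fine_cvgP : sL1 => [sfinn /cvgr0Pnorm_lt/(_ _ e20) sL1].
move/cvgrPdist_lt : sc => /(_ _ e20) sc.
near \oo => k.
have h1 : `|c - simple_int mu (s k)| < e / 2 by near: k; exact: sc.
have h2 : `|(fine \o (fun k => \int[mu]_(t in D) `|simple_fun (s k) t - g t|%:E)%E) k| < e / 2.
  by near: k; exact: sL1.
have h3 : (\int[mu]_(t in D) `|simple_fun (s k) t - g t|%:E)%E \is a fin_num.
  by near: k; exact: sfinn.
have := simple_int_dist dphi (sfin k) cg ig; rewrite -(fineK h3) lee_fin => h4.
have h5 : `|phi c - phi (simple_int mu (s k))| <= `|c - simple_int mu (s k)|.
  by rewrite -dual_ballB//; exact: dual_ball_le.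
apply: (le_trans (ler_distD (phi (simple_int mu (s k))) _ _)).
rewrite [e]splitr lerD//; first exact: le_trans h5 (ltW h1).
exact: le_trans h4 (le_trans (ler_norm _) (ltW h2)).
Unshelve. all: by end_near. Qed.

End functional.

(** * Approximation of continuous functions by step functions *)

Section steps.
Context {X : normedModType R}.
Implicit Types (g : R -> X).

(** [simple_fun] adds overlapping values. Half-open intervals make step functions on []x, y]] and
    []y, z]] concatenate without overlap. *)
Definition steps (s : seq (R * R * X)) : seq (set R * X) :=
  [seq (`]p.1.1, p.1.2]%classic, p.2) | p <- s].

Definition steps_in (a b : R) (s : seq (R * R * X)) := forall p, p \in s ->
  [/\ a <= p.1.1, p.1.1 <= p.1.2 & p.1.2 <= b].

Lemma simple_fun_cat (s1 s2 : seq (set R * X)) t :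
  simple_fun (s1 ++ s2) t = simple_fun s1 t + simple_fun s2 t :> X.
Proof. by rewrite /simple_fun big_cat. Qed.

Lemma steps_out (a b : R) s t : steps_in a b s -> ~~ ((a < t) && (t <= b)) ->
  simple_fun (steps s) t = 0 :> X.
Proof.
move=> sab tab; rewrite /simple_fun big_map big_seq big1// => p /sab [ap _ pb].
rewrite indicE memNset ?scale0r//= in_itv/= => /andP[pt tp].
by move/negP: tab; apply; rewrite (le_lt_trans ap pt) (le_trans tp pb).
Qed.

Lemma steps_finite (a b : R) s : 0 < a -> steps_in a b s -> finite_simple (steps s).
Proof.
move=> a0 sab _ /mapP[p /sab [ap pp pb] ->]; split=> /=; first exact: measurable_itv.
  move=> t; rewrite in_half_line /= in_itv/= => /andP[pt _].
  exact: lt_trans (lt_le_trans a0 ap) pt.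
rewrite lebesgue_measure_itv/=; case: ifP => // _; exact: ltry.
Qed.

(* The set of [x] such that the claim holds on [a, x] has a supremum; continuity
   there extends the claim past the supremum, unless it is [b]. *)
Lemma steps_approx g (a b e : R) : 0 < e -> 0 < a -> a <= b -> cont_pos g ->
  exists2 s, steps_in a b s &
    forall t, a < t -> t <= b -> `|simple_fun (steps s) t - g t| <= e.
Proof.
move=> e0 a0 ab cg.
pose P x y := exists2 s, steps_in x y s &
    forall t, x < t -> t <= y -> `|simple_fun (steps s) t - g t| <= e.
have Pcat x y z : x <= y -> y <= z -> P x y -> P y z -> P x z.
  move=> xy yz [s1 in1 ap1] [s2 in2 ap2]; exists (s1 ++ s2).
    move=> p; rewrite mem_cat => /orP[/in1|/in2] [? ? ?]; split=> //.
      exact: le_trans yz.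
    exact: le_trans xy _.
  move=> t xt tz; rewrite /steps map_cat simple_fun_cat.
  have [ty|yt] := leP t y.
    rewrite (steps_out in2) ?addr0; first exact: ap1.
    by rewrite ltNge ty.
  rewrite (steps_out in1) ?add0r; first exact: ap2.
  by rewrite xt/= -ltNge.
pose A : set R := [set x | [/\ a <= x, x <= b & P a x]].
have Aa : A a.
  split=> //; exists [::] => // t at' ta.
  by move: (lt_le_trans at' ta); rewrite ltxx.
have Ab : ubound A b by move=> x [].
have supA : has_sup A by split; [exists a|exists b].
pose c := sup A.
have ac : a <= c by apply: ub_le_sup => //; exists b.
have cb : c <= b by apply: ge_sup => //; exists a.
have c0 : 0 < c by exact: lt_le_trans ac.
have /cvgrPdist_le/(_ e e0) := cg c c0.
move=> /nbhs_ballP[d /= d0 hd].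
have Ploc x y : c - d < x -> x <= y -> y < c + d -> P x y.
  move=> cx xy yc; exists [:: ((x, y), g c)].
    by move=> p; rewrite inE => /eqP ->.
  move=> t xt ty; rewrite /simple_fun big_seq1/= indicE mem_set ?scale1r/=.
    apply: hd; rewrite /ball/= ltr_norml; apply/andP; split; lra.
  by rewrite in_itv/= xt ty.
have [x Ax cx] := sup_adherent d0 supA.
have [ax xb Pax] := Ax.
have xc : x <= c by apply: ub_le_sup => //; exists b.
have [bd|bd] := leP b (c + d / 2).
  by apply: (Pcat a x b) => //; apply: Ploc => //; lra.
have d20 : 0 < d / 2 by rewrite divr_gt0.
have : A (c + d / 2).
  split; [lra|exact: ltW|].
  apply: (Pcat a x) => //; first by lra.
  by apply: Ploc => //; lra.
move=> /(ub_le_sup (ex_intro _ b Ab)); rewrite -/c; lra.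
Qed.

End steps.

Lemma bochner_integral_exists (X : completeNormedModType R) (g : R -> X) :
  cont_pos g -> mu.-integrable D (EFin \o (fun s => `|g s|)) ->
  exists c, bochner_integral mu D g c.
Proof.
move=> cg ig.
pose lo (k : nat) : R := k.+1%:R^-1; pose hi (k : nat) : R := k.+1%:R.
have lo0 k : 0 < lo k by rewrite invr_gt0.
have lohi k : lo k <= hi k.
  by rewrite (@le_trans _ _ 1)// ?ler1n// invf_le1// ler1n.
(* The precision [lo k ^ 2] beats the length of [exh k], which is below [hi k = 1 / lo k]; the total
   error on [exh k] is thus at most [lo k]. *)
have /choice[s hs] k : exists s : seq (R * R * X), steps_in (lo k) (hi k) s /\
    forall t, lo k < t -> t <= hi k -> `|simple_fun (steps s) t - g t| <= lo k ^+ 2.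
  have [|s ? ?] := @steps_approx _ g _ _ (lo k ^+ 2) _ (lo0 k) (lohi k) cg.
    by rewrite exprn_gt0.
  by exists s.
have sfin k : finite_simple (steps (s k)) := steps_finite (lo0 k) (hs k).1.
pose err k := (\int[mu]_(t in D) `|simple_fun (steps (s k)) t - g t|%:E)%E.
pose bnd k := lo k ^+ 2 * (hi k - lo k) + Rintegral mu (D `\` exh k) (fun t => `|g t|).
have errb k : (err k <= (bnd k)%:E)%E.
  have muE : mu (exh k) = (hi k - lo k)%:E.
    rewrite lebesgue_measure_itv/= lte_fin; case: ifPn => // h.
    have -> : lo k = hi k by apply/eqP; rewrite eq_le lohi/= leNgt.
    by rewrite subrr.
  have [i1 e1] := @integrable_indic_pos _ (exh k) (@measurable_exh R k) (@exh_sub R k)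
     ltac:(by rewrite muE ltry).
  have i2 := integrable_indicM (@measurable_exhC R k) ig.
  have i3 := integrableRD (integrableRZ (lo k ^+ 2) i1) i2.
  have -> : bnd k = Rintegral mu D (fun t => lo k ^+ 2 * \1_(exh k) t +
      \1_(D `\` exh k) t * `|g t|).
    rewrite RintegralD//; last exact: integrableRZ.
    rewrite RintegralZl// e1 muE Rintegral_indicM//; exact: subDsetl.
  rewrite /Rintegral fineK; last exact: integrable_fin_num.
  apply: ge0_le_lower_integral => t; rewrite in_half_line lee_fin// => t0.
  rewrite !indicE; have [tin|tout] := boolP (t \in exh k).
    rewrite mulr1 memNset ?mul0r ?addr0; last by move=> [_]; apply; rewrite inE in tin.
    move: tin; rewrite inE /exh/= in_itv/= => /andP[? ?].
    exact: (hs k).2.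
  rewrite mulr0 add0r mem_set ?mul1r; last first.
    by split; [rewrite in_half_line|rewrite notin_setE in tout].
  rewrite (steps_out (hs k).1) ?sub0r ?normrN//.
  by apply: contra tout => h; rewrite inE /exh/= in_itv.
have bnd0 : bnd k @[k --> \oo] --> (0 : R).
  rewrite -[X in _ --> X](addr0 (0 : R)); apply: cvgD; last first.
    exact: ge0_cvg_Rintegral_exhC.
  apply: (@squeeze_cvgr _ _ _ _ (fun=> 0) (fun k => lo k)).
  - near=> k; have lk := lo0 k; apply/andP; split.
      by rewrite mulr_ge0 ?exprn_ge0 ?subr_ge0// ltW.
    rewrite [leRHS](_ : _ = lo k ^+ 2 * hi k); last first.
      by rewrite expr2 -mulrA mulVf ?mulr1// pnatr_eq0.
    by rewrite ler_pM2l ?exprn_gt0// gerBl ltW.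
  - exact: cvg_cst.
  - exact: cvg_harmonic.
have err_cvg : err k @[k --> \oo] --> 0%E.
  apply: (@squeeze_cvge _ _ _ _ (fun=> 0%E) _ (fun k => (bnd k)%:E)).
  - by near=> k; rewrite errb andbT integral_ge0.
  - exact: cvg_cst.
  - by apply: cvg_EFin => //; near=> k.
pose I k := simple_int mu (steps (s k)).
(* No vector integral of [g] is available yet for comparison. The difference is tested on its own
   norming functional, with the scalar integral of [phi \o g] as intermediate term. *)
have Idist k l : `|I k - I l| <= bnd k + bnd l.
  have [phi [p1 p2 p3 pE]] := norming_functional (I k - I l).
  have dphi : dual_ball phi by split.
  have hk := le_trans (simple_int_dist dphi (sfin k) cg ig) (errb k).
  have hl := le_trans (simple_int_dist dphi (sfin l) cg ig) (errb l).
  rewrite !lee_fin in hk hl.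
  rewrite -pE dual_ballB//; apply: (le_trans (ler_norm _)).
  apply: (le_trans (ler_distD (Rintegral mu D (phi \o g)) _ _)).
  by apply: lerD => //; rewrite distrC.
have : cvg (I k @[k --> \oo]).
  apply: cauchy_cvg; apply: cauchy_exP => e e0.
  have e20 : 0 < e / 2 by rewrite divr_gt0.
  move/cvgr0Pnorm_lt : bnd0 => /(_ _ e20) [N _ hN].
  exists (I N); exists N => // k /= Nk; rewrite -ball_normE/=.
  apply: (le_lt_trans (Idist N k)); rewrite [e]splitr.
  have hb l : (N <= l)%N -> bnd l < e / 2.
    by move=> /hN; apply: le_lt_trans; exact: ler_norm.
  by rewrite ltrD// hb.
move=> /cvg_ex[c Ic]; exists c, (fun k => steps (s k)); split=> //.
apply: aeW => t; rewrite in_half_line => t0.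
have [K _ Kt] : (\bigcup_k exh k) t by rewrite bigcup_exh in_half_line.
apply/cvgrPdist_lt => e e0.
have /cvgr0Pnorm_lt/(_ e e0)[N _ hN] := @cvg_harmonic R.
exists (maxn K N) => // k /=; rewrite geq_max => /andP[Kk Nk].
have tk : exh k t by have /subsetPset := @exh_nd R _ _ Kk; exact.
move: tk; rewrite /exh/= in_itv/= => /andP[lt1 lt2].
rewrite distrC; apply: (le_lt_trans ((hs k).2 t lt1 lt2)).
have := hN k Nk; rewrite /harmonic/= ger0_norm ?invr_ge0//; apply: le_lt_trans.
rewrite expr2 -[leRHS]mul1r ler_wpM2r ?invr_ge0//.
by rewrite invf_le1// ler1n.
Unshelve. all: by end_near. Qed.

End bochner.

(** * A Riemann-Lebesgue lemma *)

Section riemann_lebesgue.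
Context {R : realType} {X : normedModType R}.
Local Notation mu := (@lebesgue_measure R).
Local Notation D := [set` `]0%R, +oo[ : interval R].
Implicit Types (b e : R) (g : R -> X) (phi : X -> R) (p : {poly R}).

(** The common size of both estimates. At [n = 0] it is 0 by the convention for inverses, and the
    bounds below start at positive [n]. *)
Definition lagrate n b : R := lagnorm n b / Num.sqrt n%:R.

Lemma lagrate_gt0 n b : -1 < b -> (0 < n)%N -> 0 < lagrate n b.
Proof. by move=> b1 n0; rewrite divr_gt0 ?lagnorm_gt0// sqrtr_gt0 ltr0n. Qed.

Lemma amgm (l x y : R) : 0 < l -> `|x * y| <= 2^-1 * (l * x ^+ 2 + l^-1 * y ^+ 2).
Proof.
move=> l0; rewrite normrM -subr_ge0 -[x ^+ 2]real_normK ?num_real//.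
rewrite -[y ^+ 2]real_normK ?num_real//.
have -> : 2^-1 * (l * `|x| ^+ 2 + l^-1 * `|y| ^+ 2) - `|x| * `|y| =
  (2 * l)^-1 * (l * `|x| - `|y|) ^+ 2 by field; rewrite gt_eqF.
by rewrite mulr_ge0 ?sqr_ge0// invr_ge0 mulr_ge0// ltW.
Qed.

(** Stands in for the Cauchy-Schwarz inequality: [1 / (1 + s)] goes to the Laguerre factor, as in
    the resolvent bound, and [1 + s] to the other one. The parameter [l] is chosen at the end. *)
Lemma weighted_amgm b (l x y s : R) : 0 < l -> 0 < s ->
  `|weight b s * (x * y)| <=
    2^-1 * (l * (weight b s * (x ^+ 2 * (1 + s)^-1)) +
            l^-1 * (weight b s * (1 + s) * y ^+ 2)).
Proof.
move=> l0 s0; have s1 : 0 < 1 + s by lra.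
have l1 : 0 < l * (1 + s)^-1 by rewrite mulr_gt0// invr_gt0.
rewrite normrM ger0_norm ?weight_ge0//.
have := ler_wpM2l (weight_ge0 b s) (amgm x y l1).
rewrite invfM invrK => /le_trans; apply.
by rewrite le_eqVlt; apply/orP; left; apply/eqP; ring.
Qed.

Lemma integrable_weight_horner b g phi p : -1 < b -> cont_pos g -> dual_ball phi ->
  mu.-integrable D (EFin \o (fun s => weight b s * (1 + s) * `|g s| ^+ 2)) ->
  mu.-integrable D (EFin \o (fun s => weight b s * (p.[s] * phi (g s)))).
Proof.
move=> b1 cg dphi ig.
have gp : pgrow (fun s => p.[s] ^+ 2 * (1 + s)^-1).
  apply: pgrowM; last exact: pgrow_inv1D.
  by apply: pgrowM; exact: pgrow_horner.
have i1 := integrableRZ 2^-1 (integrableRD (integrableRZ 1 (integrable_weight b1 gp))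
  (integrableRZ 1^-1 ig)).
apply: integrable_le i1 _.
  apply: cont_pos_measurable; apply: cont_posM; first exact: cont_pos_weight.
  by apply: cont_posM; [case: (pgrow_horner p)|exact: (dual_ball_continuous dphi cg)].
move=> s s0; apply: (le_trans (weighted_amgm _ _ _ ltr01 s0)).
rewrite ler_wpM2l ?invr_ge0// lerD2l ler_wpM2l ?invr_ge0//.
apply: ler_wpM2l; first by rewrite mulr_ge0 ?weight_ge0//; lra.
rewrite -[leLHS]real_normK ?num_real//; apply: lerXn2r; rewrite ?nnegrE//.
exact: dual_ball_le.
Qed.

(* By Rodrigues' formula the integral consists of two boundary terms, which gain
   a factor [n ^ (-1/2)] over the pointwise size of [L_n]. *)
Lemma laguerre_interval_bound b (x y : R) : -1 < b -> 0 < x -> x <= y ->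
  exists2 C : R, 0 <= C & forall n, (2 < n)%N ->
    `|Rintegral mu `]x, y] (fun s => weight b s * (lagp n b).[s])| <=
      C * (Num.sqrt (lagrate n b) / Num.sqrt n%:R).
Proof.
move=> b1 x0 xy; have y0 : 0 < y by exact: lt_le_trans xy.
have b2 : -1 < b + 1 by lra.
have [Cx Cx0 hx] := laguerre_pointwise_bound b2 x0.
have [Cy Cy0 hy] := laguerre_pointwise_bound b2 y0.
(* The factor 2 under the roots again replaces [sqrt m] by [sqrt (m + 1)]. *)
exists (weight (b + 1) y * Num.sqrt (2 * Cy) + weight (b + 1) x * Num.sqrt (2 * Cx)).
  by rewrite addr_ge0// mulr_ge0 ?weight_ge0 ?sqrtr_ge0.
move=> [|m]// m2; have {}m2 : (1 < m)%N by rewrite -ltnS.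
have m0 : (0 < m)%N by exact: ltnW.
set n : R := m.+1%:R; have n0 : 0 < n by [].
have q0 := lagrate_gt0 b1 (ltn0Sn m); set q := lagrate m.+1 b in q0 *.
pose F s := weight (b + 1) s * (n^-1 * (lagp m (b + 1)).[s]).
have dF (s : R) : 0 < s -> is_derive s 1 F (weight b s * (lagp m.+1 b).[s]).
  move=> s0.
  have d2 : is_derive s 1 (fun u : R => n^-1 * (lagp m (b + 1)).[u])
      (n^-1 * (lagp m (b + 1))^`().[s]).
    rewrite (_ : (fun u : R => _) = horner (n^-1 *: lagp m (b + 1))); last first.
      by apply/funext => u; rewrite hornerZ.
    rewrite -hornerZ -derivZ; apply: DeriveDef; first exact: derivable_horner.
    by rewrite -derive1E -derivE.
  apply: (is_derive_eq (is_deriveM (is_derive_weightS b s0) d2)).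
  rewrite /GRing.scale/= weightS//.
  have := congr1 (fun r => r.[s]) (lagp_rodrigues m b); rewrite !hornerE /= -/n => e.
  have -> : (lagp m.+1 b).[s] = n^-1 * (n * (lagp m.+1 b).[s]).
    by rewrite mulKf// gt_eqF.
  by rewrite -e /weight; ring.
have cw : cont_pos (fun s => weight b s * (lagp m.+1 b).[s]).
  by apply: cont_posM; [exact: cont_pos_weight|case: (pgrow_horner (lagp m.+1 b))].
have [_ ->] := Rintegral_FTC x0 xy cw dF.
have Fb u C : 0 < u -> 0 <= C ->
    (lagp m (b + 1)).[u] ^+ 2 <= C * (lagnorm m (b + 1) / Num.sqrt m%:R) ->
    `|F u| <= weight (b + 1) u * Num.sqrt (2 * C) * (Num.sqrt q / Num.sqrt n).
  move=> u0 C0 hu; rewrite /F normrM ger0_norm ?weight_ge0// -mulrA.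
  rewrite ler_wpM2l ?weight_ge0// normrM gtr0_norm ?invr_gt0//.
  rewrite mulrC ler_pdivrMr//.
  have -> : Num.sqrt (2 * C) * (Num.sqrt q / Num.sqrt n) * n =
      Num.sqrt (2 * C * q * n).
    have sn : 0 < Num.sqrt n by rewrite sqrtr_gt0.
    have nE : n = Num.sqrt n * Num.sqrt n by rewrite -expr2 sqr_sqrtr// ltW.
    have C20 : 0 <= 2 * C by rewrite mulr_ge0.
    have Cq0 : 0 <= 2 * C * q by rewrite mulr_ge0// ltW.
    rewrite (sqrtrM _ Cq0) (sqrtrM _ C20) [X in _ * X = _]nE.
    by field; rewrite gt_eqF.
  rewrite -sqrtr_sqr ler_wsqrtr//; apply: (le_trans hu).
  rewrite lagnorm_shiftS -/n /q /lagrate -/n.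
  have := ler_wpM2l (mulr_ge0 C0 (mulr_ge0 (ltW n0) (ltW (lagnorm_gt0 m.+1 b1))))
    (sqrt_half_bound m0).
  rewrite -/n => h; apply: le_trans (le_trans h _).
    by rewrite !mulrA.
  by rewrite le_eqVlt; apply/orP; left; apply/eqP; ring.
apply: (le_trans (ler_normB _ _)); rewrite mulrDl; apply: lerD.
  by apply: Fb => //; exact: hy.
by apply: Fb => //; exact: hx.
Qed.

(** The functional enters only through [|phi p.2| <= |p.2|], so [C] can be chosen before it. *)
Lemma laguerre_steps_bound b (st : seq (R * R * X)) (lo hi : R) : -1 < b -> 0 < lo ->
  steps_in lo hi st ->
  exists2 C : R, 0 <= C & forall phi, dual_ball phi -> forall n, (2 < n)%N ->
    mu.-integrable D (EFin \o (fun s => weight b s *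
        ((lagp n b).[s] * phi (simple_fun (steps st) s)))) /\
    `|Rintegral mu D (fun s => weight b s *
        ((lagp n b).[s] * phi (simple_fun (steps st) s)))| <=
      C * (Num.sqrt (lagrate n b) / Num.sqrt n%:R).
Proof.
move=> b1 lo0; elim: st => [|p st IH] sin.
  exists 0 => // phi dphi n n2.
  have e : (fun s => weight b s * ((lagp n b).[s] * phi (simple_fun (steps [::]) s)))
      = cst 0 :> (R -> R).
    by apply/funext => s; rewrite /simple_fun big_nil dual_ball0// !mulr0.
  rewrite e mul0r; split; first exact: integrable0.
  by rewrite /Rintegral integral0_eq//= normr0.
have sin' : steps_in lo hi st by move=> q qs; apply: sin; rewrite inE qs orbT.
have [p1 p2 p3] := sin p (mem_head _ _).
have p0 : 0 < p.1.1 by exact: lt_le_trans p1.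
have [C1 C10 h1] := laguerre_interval_bound b1 p0 p2.
have [C2 C20 h2] := IH sin'.
exists (`|p.2| * C1 + C2); first by rewrite addr_ge0// mulr_ge0.
move=> phi dphi n n2; have [i2 {}h2] := h2 phi dphi n n2.
have [pn pD pZ] := dphi.
pose I := `]p.1.1, p.1.2]%classic : set R.
have ID : I `<=` D.
  move=> s; rewrite in_half_line /I/= in_itv/= => /andP[ps _]; exact: lt_trans ps.
have e : (fun s => weight b s * ((lagp n b).[s] * phi (simple_fun (steps (p :: st)) s)))
  = (fun s => phi p.2 * (\1_I s * (weight b s * (lagp n b).[s])) +
       weight b s * ((lagp n b).[s] * phi (simple_fun (steps st) s))) :> (R -> R).
  by apply/funext => s; rewrite [steps _]/= simple_fun_cons pD pZ; ring.
have iw := integrable_weight b1 (pgrow_horner (lagp n b)).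
have i1 := integrable_indicM (measurable_itv _ : measurable I) iw.
rewrite e; split; first by apply: integrableRD => //; exact: integrableRZ.
rewrite RintegralD//; last exact: integrableRZ.
rewrite RintegralZl// Rintegral_indicM//.
apply: (le_trans (ler_normD _ _)); rewrite mulrDl; apply: lerD => //.
rewrite normrM -mulrA; apply: ler_pM => //; exact: h1.
Qed.

(** The step approximation lies within [e'] of [g] on [exh k] and vanishes outside. Its squared
    distance to [g] in the weighted space is at most [e' ^ 2 M] plus a tail of the integral of [W].
    Both choices precede the functional, so [N] does not depend on it. *)
Lemma laguerre_riemann_lebesgue b g e : -1 < b -> cont_pos g -> 0 < e ->
  mu.-integrable D (EFin \o (fun s => weight b s * (1 + s) * `|g s| ^+ 2)) ->
  exists N, forall n, (N <= n)%N -> forall phi, dual_ball phi ->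
    `|Rintegral mu D (fun s => weight b s * ((lagp n b).[s] * phi (g s)))| <=
      e * Num.sqrt (lagrate n b).
Proof.
move=> b1 cg e0 ig.
pose K := 3 + `|b|; have K0 : 0 < K by rewrite /K; have := normr_ge0 b; lra.
(* With [l = d / sqrt q] below, [l K q] and [2 eta / l] both equal [e / 2 * sqrt q], and so does
   their mean. *)
pose d := e / (2 * K); have d0 : 0 < d by rewrite divr_gt0// mulr_gt0.
pose eta := e * d / 4; have eta0 : 0 < eta by rewrite divr_gt0// mulr_gt0.
pose W s := weight b s * (1 + s) * `|g s| ^+ 2.
have W0 s : 0 < s -> 0 <= W s.
  by move=> s0; rewrite mulr_ge0 ?sqr_ge0// mulr_ge0 ?weight_ge0//; lra.
have /cvgr0Pnorm_lt/(_ eta eta0) [k _ /(_ k (leqnn k)) hk] := ge0_cvg_Rintegral_exhC ig W0.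
have g1 : pgrow (fun s : R => 1 + s) by apply: pgrowD; [exact: pgrow_cst|exact: pgrow_id].
pose M := wint b (fun s => 1 + s).
have M0 : 0 <= M by apply: wint_ge0 => s s0; lra.
pose e' := Num.sqrt (eta / (M + 1)).
have e'0 : 0 < e' by rewrite sqrtr_gt0 divr_gt0//; lra.
have e'M : e' ^+ 2 * M <= eta.
  rewrite sqr_sqrtr; last by rewrite divr_ge0 ?ltW//; lra.
  rewrite mulrAC ler_pdivrMr; last lra.
  by rewrite ler_pM2l//; lra.
pose lo : R := k.+1%:R^-1; pose hi : R := k.+1%:R.
have lo0 : 0 < lo by rewrite invr_gt0.
have lohi : lo <= hi by rewrite (@le_trans _ _ 1)// ?ler1n// invf_le1// ler1n.
have [st stin stap] := steps_approx e'0 lo0 lohi cg.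
pose sg := simple_fun (steps st).
have [C C0 hC] := laguerre_steps_bound b1 lo0 stin.
pose H s := e' ^+ 2 * (weight b s * (1 + s)) + \1_(D `\` exh k) s * W s.
have iH1 := integrable_weight b1 g1.
have iH2 := integrable_indicM (@measurable_exhC R k) ig.
have iH : mu.-integrable D (EFin \o H).
  by apply: integrableRD => //; exact: integrableRZ.
have HI : Rintegral mu D H <= 2 * eta.
  rewrite RintegralD//; last exact: integrableRZ.
  rewrite RintegralZl// Rintegral_indicM; last exact: subDsetl.
  have := ler_norm (Rintegral mu (D `\` exh k) W).
  move: hk e'M; rewrite /M /wint /W; set u := Rintegral _ _ _; set v := Rintegral _ _ _; lra.
have rH s phi : 0 < s -> dual_ball phi ->
    weight b s * (1 + s) * (phi (g s) - phi (sg s)) ^+ 2 <= H s.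
  move=> s0 dphi; have w0 : 0 <= weight b s * (1 + s).
    by rewrite mulr_ge0 ?weight_ge0//; lra.
  have le1 : (phi (g s) - phi (sg s)) ^+ 2 <= `|g s - sg s| ^+ 2.
    rewrite -dual_ballB// -[leLHS]real_normK ?num_real//.
    by apply: lerXn2r; rewrite ?nnegrE//; exact: dual_ball_le.
  apply: (le_trans (ler_wpM2l w0 le1)); rewrite /H indicE.
  have [tin|tout] := boolP (s \in exh k).
    rewrite memNset ?mul0r ?addr0; last by move=> [_]; apply; rewrite inE in tin.
    rewrite mulrC ler_wpM2r//; apply: lerXn2r; rewrite ?nnegrE//; first exact: ltW.
    by move: tin; rewrite inE /exh/= in_itv/= distrC => /andP[? ?]; exact: stap.
  rewrite mem_set ?mul1r; last first.
    by split; [rewrite in_half_line|rewrite notin_setE in tout].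
  rewrite /sg (steps_out stin) ?subr0; last first.
    by apply: contra tout => h; rewrite inE /exh/= in_itv.
  by rewrite lerDr mulr_ge0// sqr_ge0.
(* From here on [sqrt n >= 2 C / e], which makes the contribution of the step function at most
   [e / 2 * sqrt q]. *)
pose N0 := Num.bound ((2 * C / e) ^+ 2).
exists (maxn 3 N0) => n; rewrite geq_max => /andP[n2 nN] phi dphi.
have n0 : (0 < n)%N by exact: leq_ltn_trans n2.
have [isg hsg] := hC phi dphi n n2.
have q0 := lagrate_gt0 b1 n0; set q := lagrate n b in q0 hsg *.
have sq0 : 0 < Num.sqrt q by rewrite sqrtr_gt0.
have sn0 : 0 < Num.sqrt n%:R :> R by rewrite sqrtr_gt0 ltr0n.
have hsg' : C * (Num.sqrt q / Num.sqrt n%:R) <= e / 2 * Num.sqrt q.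
  have -> : C * (Num.sqrt q / Num.sqrt n%:R) = C / Num.sqrt n%:R * Num.sqrt q by ring.
  rewrite ler_pM2r// ler_pdivrMr// [leRHS]mulrC -ler_pdivrMr; last by rewrite divr_gt0.
  have -> : C / (e / 2) = 2 * C / e by field; rewrite gt_eqF.
  rewrite -[leLHS]ger0_norm; last by rewrite divr_ge0 ?mulr_ge0// ltW.
  rewrite -sqrtr_sqr ler_wsqrtr//.
  apply: (le_trans (ltW (archi_boundP (sqr_ge0 _)))).
  by rewrite ler_nat.
have iphig := integrable_weight_horner (lagp n b) b1 cg dphi ig.
have idiff := integrableRB iphig isg.
have gG : pgrow (fun s => (lagp n b).[s] ^+ 2 * (1 + s)^-1).
  by apply: pgrowM; [apply: pgrowM; exact: pgrow_horner|exact: pgrow_inv1D].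
pose l := d / Num.sqrt q; have l0 : 0 < l by rewrite divr_gt0.
have iG := integrable_weight b1 gG.
have imaj := integrableRZ 2^-1 (integrableRD (integrableRZ l iG) (integrableRZ l^-1 iH)).
have hdiff : `|Rintegral mu D (fun s => weight b s * ((lagp n b).[s] * phi (g s)) -
     weight b s * ((lagp n b).[s] * phi (sg s)))| <= e / 2 * Num.sqrt q.
  apply: (le_trans (le_normr_Rintegral _ idiff)) => //.
  apply: (@le_trans _ _ (2^-1 * (l * (K * q) + l^-1 * (2 * eta)))); last first.
    rewrite le_eqVlt; apply/orP; left; apply/eqP.
    rewrite /l /eta /d -{2}(sqr_sqrtr (ltW q0)).
    by field; rewrite !gt_eqF.
  apply: (@le_trans _ _ (Rintegral mu D (fun s => 2^-1 * (l * (weight b s *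
      ((lagp n b).[s] ^+ 2 * (1 + s)^-1)) + l^-1 * H s)))).
    apply: le_Rintegral => //; first exact: (integrable_norm idiff).
    move=> s; rewrite in_half_line => s0.
    rewrite -mulrBr -mulrBr; apply: (le_trans (weighted_amgm _ _ _ l0 s0)).
    rewrite ler_wpM2l ?invr_ge0// lerD2l ler_pM2l ?invr_gt0//.
    exact: rH.
  rewrite RintegralZl//; last first.
    exact: (integrableRD (integrableRZ l iG) (integrableRZ l^-1 iH)).
  rewrite ler_wpM2l ?invr_ge0// RintegralD//; [|exact: integrableRZ..].
  rewrite !RintegralZl//; apply: lerD; rewrite ler_pM2l ?invr_gt0//.
  exact: laguerre_resolvent_bound.
have -> : Rintegral mu D (fun s => weight b s * ((lagp n b).[s] * phi (g s))) =
   Rintegral mu D (fun s => weight b s * ((lagp n b).[s] * phi (g s)) -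
     weight b s * ((lagp n b).[s] * phi (sg s))) +
   Rintegral mu D (fun s => weight b s * ((lagp n b).[s] * phi (sg s))).
  by rewrite RintegralB// subrK.
apply: (le_trans (ler_normD _ _)).
have -> : e * Num.sqrt q = e / 2 * Num.sqrt q + e / 2 * Num.sqrt q by field.
by apply: lerD => //; exact: le_trans hsg hsg'.
Qed.

End riemann_lebesgue.

(** * Pointwise convergence *)

(** The factor [n + b + 1] between the norms for [b] and [b + 1] contributes [sqrt n] under the
    square root, which offsets the two factors [n ^ (-1/4)] of the rates. *)
Lemma lagrate_product {R : realType} n (b : R) : -1 < b -> (0 < n)%N ->
  Num.sqrt (lagrate n b) * Num.sqrt (lagrate n (b + 1)) <=
  Num.sqrt (2 + `|b|) * lagnorm n b.
Proof.
move=> b1 n0; have n1 : 1 <= n%:R :> R by rewrite ler1n.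
have q0 := lagrate_gt0 b1 n0; have h0 := lagnorm_gt0 n b1.
have A0 : 0 <= n%:R + b + 1 :> R by lra.
have k0 : 0 <= 2 + `|b| by rewrite addr_ge0.
have AE : n%:R + b + 1 <= (2 + `|b|) * n%:R.
  have := ler_norm b; have := normr_ge0 b; nra.
have sn0 : 0 < Num.sqrt n%:R :> R by rewrite sqrtr_gt0; lra.
rewrite -sqrtrM; last exact: ltW.
have -> : lagrate n b * lagrate n (b + 1) = lagrate n b ^+ 2 * (n%:R + b + 1).
  by rewrite /lagrate lagnorm_shift//; ring.
rewrite sqrtrM; last exact: sqr_ge0.
rewrite sqrtr_sqr (gtr0_norm q0) /lagrate mulrAC ler_pdivrMr//.
by rewrite mulrC mulrAC ler_pM2r// -sqrtrM// ler_wsqrtr.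
Qed.

(** Here [x], [x'] stand for the values at [t] for the two parameters, [y], [y'] for the integrals
    against the difference quotient, and [r], [r'] for the roots of the rates. Each product mixes
    the parameters, so both carry [r * r']. *)
Lemma error_combination {R : realType} (h r r' e k c c' t x x' y y' : R) :
  0 < h -> 0 <= t -> 0 <= e -> 0 <= c -> 0 <= c' -> r * r' <= k * h ->
  `|x| <= c * r -> `|x'| <= c' * r' -> `|y| <= e * r -> `|y'| <= e * r' ->
  h^-1 * (x * y' - t * x' * y) <= e * (k * (c + t * c')).
Proof.
move=> h0 t0 e0 c0 c'0 rk hx hx' hy hy'; rewrite mulrC ler_pdivrMr//.
apply: (le_trans (ler_norm _)); apply: (le_trans (ler_normB _ _)).
rewrite !normrM (ger0_norm t0).
have h1 := ler_pM (normr_ge0 _) (normr_ge0 _) hx hy'.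
have h2 := ler_wpM2l t0 (ler_pM (normr_ge0 _) (normr_ge0 _) hx' hy).
apply: (@le_trans _ _ (e * (c + t * c') * (r * r'))).
  apply: (le_trans (lerD h1 _)); first by rewrite -mulrA; exact: h2.
  by rewrite le_eqVlt; apply/orP; left; apply/eqP; ring.
have -> : e * (k * (c + t * c')) * h = e * (c + t * c') * (k * h) by ring.
by rewrite ler_wpM2l// mulr_ge0// addr_ge0// mulr_ge0.
Qed.

(** * The difference quotient of [f] at [t] *)

Section difference_quotient.
Context {R : realType} {X : normedModType R}.
Variables (f : R -> X) (t : R).
Hypotheses (df : forall s : R, 0 < s -> derivable f s 1) (t0 : 0 < t).

Definition diffq (s : R) : X :=
  if s == t then 'D_1 f t else (s - t)^-1 *: (f s - f t).

Lemma diffqE s : (s - t) *: diffq s = f s - f t.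
Proof.
rewrite /diffq; case: eqP => [->|/eqP st]; first by rewrite !subrr scale0r.
by rewrite scalerA mulfV ?scale1r// subr_eq0.
Qed.

Lemma derivable_cont_pos : cont_pos f.
Proof.
by move=> s s0; apply/differentiable_continuous/derivable1_diffP; exact: df.
Qed.

(** Continuity at [t] is the differentiability of [f] there; at other points continuity of [f]
    suffices. *)
Lemma diffq_cont_pos : cont_pos diffq.
Proof.
move=> s s0; have [->|st] := eqVneq s t.
  apply/cvgrPdist_lt => e e0; rewrite /diffq eqxx.
  have H : (fun h => h^-1 *: ((f \o shift t) (h *: 1) - f t)) @ 0^' --> 'D_1 f t.
    exact: df.
  move/cvgrPdist_lt : H => /(_ e e0); rewrite near_withinE => /nbhs_ballP[d /= d0 hd].
  apply/nbhs_ballP; exists d => // x /= xd.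
  case: eqP => [_|/eqP xt]; first by rewrite subrr normr0.
  have xt0 : x - t != 0 by rewrite subr_eq0.
  have := hd (x - t); rewrite /= /ball/= sub0r normrN distrC => /(_ xd xt0).
  by rewrite /= [(x - t) *: 1]mulr1 subrK.
change (diffq x @[x --> s] --> diffq s).
have -> : diffq s = (s - t)^-1 *: (f s - f t) by rewrite /diffq ifN.
have c : (fun x => (x - t)^-1 *: (f x - f t)) x @[x --> s] --> (s - t)^-1 *: (f s - f t).
  apply: cvgZ.
    apply: cvgV; first by rewrite subr_eq0.
    by apply: cvgB; [exact: cvg_id|exact: cvg_cst].
  by apply: cvgB; [exact: derivable_cont_pos|exact: cvg_cst].
apply: cvg_trans c; apply: near_eq_cvg; near=> x.
rewrite /diffq ifN//; near: x.
have : 0 < `|s - t| by rewrite normr_gt0 subr_eq0.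
move=> d0; apply/nbhs_ballP; exists `|s - t| => // x /=.
by rewrite /ball/=; apply: contraTneq => ->; rewrite ltxx.
Unshelve. all: by end_near. Qed.

Lemma diffq_bound : exists2 C : R, 0 <= C &
  forall s, 0 < s -> (1 + s) ^+ 2 * `|diffq s| ^+ 2 <= C * (1 + `|f s| ^+ 2).
Proof.
have tp := t0; have t2 : t / 2 <= 2 * t by lra.
have cn : {within `[t / 2, 2 * t], continuous (fun s => `|diffq s|)}.
  apply: continuous_in_subspaceT => s; rewrite inE/= in_itv/= => /andP[ts _].
  by apply: (cont_pos_norm diffq_cont_pos); lra.
have [m _ hm] := EVT_max t2 cn; set M := `|diffq m| in hm.
(* Chosen so that [c (1 + s) <= |s - t|] outside [[t / 2, 2 t]]; inside, [diffq] is bounded by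
   compactness. *)
pose c := t / (2 * (1 + t)).
have c0 : 0 < c by rewrite divr_gt0//; lra.
have c20 : 0 < c ^+ 2 by rewrite exprn_gt0.
exists ((1 + 2 * t) ^+ 2 * M ^+ 2 + 2 * (1 + `|f t| ^+ 2) / c ^+ 2).
  apply: addr_ge0; first by rewrite mulr_ge0 ?sqr_ge0.
  by rewrite divr_ge0 ?sqr_ge0// mulr_ge0// addr_ge0 ?sqr_ge0.
move=> s s0.
set A := (1 + 2 * t) ^+ 2 * M ^+ 2; set B := 2 * (1 + `|f t| ^+ 2) / c ^+ 2.
have A0 : 0 <= A by rewrite mulr_ge0 ?sqr_ge0.
have B0 : 0 <= B by rewrite divr_ge0 ?sqr_ge0// mulr_ge0// addr_ge0 ?sqr_ge0.
have fs0 := sqr_ge0 `|f s|; have ft0 := sqr_ge0 `|f t|.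
have [/andP[s1 s2]|sout] := boolP ((t / 2 <= s) && (s <= 2 * t)).
  apply: (@le_trans _ _ A); last by nra.
  rewrite /A; apply: ler_pM; rewrite ?sqr_ge0//.
    by apply: lerXn2r; rewrite ?nnegrE; lra.
  apply: lerXn2r; rewrite ?nnegrE ?normr_ge0//.
  by apply: hm; rewrite in_itv/= s1.
have cs : c * (1 + s) <= `|s - t|.
  rewrite /c mulrAC ler_pdivrMr; last lra.
  move: sout; rewrite negb_and -!ltNge => /orP[st|st].
  - rewrite ltr0_norm; last lra.
    nra.
  - rewrite gtr0_norm; last lra.
    nra.
have le1 : c * ((1 + s) * `|diffq s|) <= `|f s| + `|f t|.
  rewrite mulrA; apply: (le_trans (ler_wpM2r (normr_ge0 _) cs)).
  by rewrite -normrZ diffqE ler_normB.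
have le2 : c ^+ 2 * ((1 + s) ^+ 2 * `|diffq s| ^+ 2) <= 2 * (`|f s| ^+ 2 + `|f t| ^+ 2).
  rewrite -!exprMn; apply: (@le_trans _ _ ((`|f s| + `|f t|) ^+ 2)).
    have s10 : 0 <= 1 + s by lra.
    have nn := mulr_ge0 (ltW c0) (mulr_ge0 s10 (normr_ge0 (diffq s))).
    by apply: lerXn2r; rewrite ?nnegrE ?addr_ge0.
  have := sqr_ge0 (`|f s| - `|f t|); rewrite sqrrB sqrrD; lra.
apply: (@le_trans _ _ (2 * (`|f s| ^+ 2 + `|f t| ^+ 2) / c ^+ 2)).
  by rewrite ler_pdivlMr// mulrC.
apply: (@le_trans _ _ (B * (1 + `|f s| ^+ 2))).
  rewrite /B [leRHS]mulrAC ler_pM2r ?invr_gt0//; nra.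
by rewrite ler_wpM2r ?lerDr// addr_ge0.
Qed.

End difference_quotient.

(** * Partial sums of the expansion *)

Section laguerre_expansion.
Context {R : realType} {X : completeNormedModType R}.
Local Notation mu := (@lebesgue_measure R).
Local Notation D := [set` `]0%R, +oo[ : interval R].
Variables (alpha : R) (f : R -> X).
Hypotheses (a1 : -1 < alpha) (df : forall s : R, 0 < s -> derivable f s 1).
Hypothesis iF : mu.-integrable D (EFin \o (fun s => weight alpha s * `|f s| ^+ 2)).

Lemma ellE n s : ell n alpha s =
  (lagnorm n alpha)^-1 * (weight alpha s * (lagp n alpha).[s]).
Proof.
rewrite /ell horner_lagp /lagnorm /weight invf_div; ring.
Qed.

Lemma integrable_weight_f (p : {poly R}) :
  mu.-integrable D (EFin \o (fun s => weight alpha s * (p.[s] * `|f s|))).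
Proof.
have gp : pgrow (fun s => p.[s] * p.[s]) by apply: pgrowM; exact: pgrow_horner.
have i1 := integrableRZ 2^-1 (integrableRD (integrable_weight a1 gp) iF).
apply: integrable_le i1 _.
  apply: cont_pos_measurable; apply: cont_posM; first exact: cont_pos_weight.
  apply: cont_posM; first by case: (pgrow_horner p).
  exact: cont_pos_norm (derivable_cont_pos df).
move=> s s0; rewrite normrM ger0_norm ?weight_ge0// -mulrDr mulrCA.
rewrite ler_wpM2l ?weight_ge0//; have := amgm p.[s] `|f s| ltr01.
by rewrite invr1 !mul1r -expr2.
Qed.

Lemma cont_pos_ell n : cont_pos (fun s => ell n alpha s *: f s).
Proof.
move=> s s0; apply: cvgZ; last exact: (derivable_cont_pos df).
have : cont_pos (fun s => (lagnorm n alpha)^-1 * (weight alpha s * (lagp n alpha).[s])).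
  apply: cont_posM; first by case: (pgrow_cst (lagnorm n alpha)^-1).
  by apply: cont_posM; [exact: cont_pos_weight|case: (pgrow_horner (lagp n alpha))].
rewrite (_ : (fun s => _) = ell n alpha); first by apply.
by apply/funext => u; rewrite ellE.
Qed.

Lemma integrable_ell n :
  mu.-integrable D (EFin \o (fun s => `|ell n alpha s *: f s|)).
Proof.
have h0 := lagnorm_gt0 n a1.
have := integrableRZ (lagnorm n alpha)^-1 (integrable_weight_f (lagp n alpha)).
move=> /integrable_norm; apply: eq_integrable => // s _ /=.
by congr (_%:E); rewrite ellE [RHS]normrZ !normrM normr_id; ring.
Qed.

Variable t : R.
Hypothesis t0 : 0 < t.
Let g := diffq f t.
Let cg : cont_pos g := diffq_cont_pos df t0.

(** For the parameter [alpha + 1] the density is [s (1 + s)] times [weight alpha]; this is where the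
    full factor [(1 + s) ^ 2] of [diffq_bound] is spent. *)
Let ig0 : mu.-integrable D (EFin \o (fun s => weight alpha s * (1 + s) * `|g s| ^+ 2)) /\
  mu.-integrable D (EFin \o (fun s => weight (alpha + 1) s * (1 + s) * `|g s| ^+ 2)).
Proof.
have [C C0 hC] := diffq_bound df t0.
have i0 := integrableRZ C (integrableRD (integrable_weight a1 (pgrow_cst (1 : R))) iF).
have mg b : measurable_fun D (fun s => weight b s * (1 + s) * `|g s| ^+ 2).
  apply: cont_pos_measurable; apply: cont_posM.
    apply: cont_posM; first exact: cont_pos_weight.
    by move=> s s0; apply: cvgD; [exact: cvg_cst|exact: cvg_id].
  by apply: cont_posM; exact: cont_pos_norm.
have key s : 0 < s -> weight alpha s * ((1 + s) ^+ 2 * `|g s| ^+ 2) <=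
    C * (weight alpha s * 1 + weight alpha s * `|f s| ^+ 2).
  by move=> s0; rewrite -mulrDr [leRHS]mulrCA ler_wpM2l ?weight_ge0// hC.
split; apply: (integrable_le _ i0) => // s s0; apply: le_trans (key s s0).
- rewrite ger0_norm; last by rewrite mulr_ge0 ?sqr_ge0// mulr_ge0 ?weight_ge0//; lra.
  rewrite -mulrA ler_wpM2l ?weight_ge0// ler_wpM2r ?sqr_ge0// expr2 ler_peMr; lra.
- rewrite weightS// ger0_norm; last first.
    by rewrite !mulr_ge0 ?sqr_ge0 ?powR_ge0 ?expR_ge0//; lra.
  have -> : s * weight alpha s * (1 + s) * `|g s| ^+ 2 =
    weight alpha s * (s * (1 + s) * `|g s| ^+ 2) by ring.
  rewrite ler_wpM2l ?weight_ge0// ler_wpM2r ?sqr_ge0// expr2 ler_wpM2r; lra.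
Qed.

Section with_functional.
Variable phi : X -> R.
Hypothesis dphi : dual_ball phi.

(** Linear in [p], so an entire partial sum becomes [J] of a single polynomial and the kernel
    identity applies under the integral. *)
Let J (p : {poly R}) := Rintegral mu D (fun s => weight alpha s * (p.[s] * phi (g s))).

Let iJ p : mu.-integrable D (EFin \o (fun s => weight alpha s * (p.[s] * phi (g s)))).
Proof. by apply: integrable_weight_horner => //; case: ig0. Qed.

Let JD p q : J (p + q) = J p + J q.
Proof.
rewrite /J -RintegralD//; apply: eq_Rintegral => s _; rewrite hornerD; ring.
Qed.

Let JZ c p : J (c *: p) = c * J p.
Proof. by rewrite /J -RintegralZl//; apply: eq_Rintegral => s _; rewrite hornerZ; ring. Qed.

Let Jsum (F : nat -> {poly R}) N : J (\sum_(n < N) F n) = \sum_(n < N) J (F n).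
Proof.
elim: N => [|N IH]; last by rewrite !big_ord_recr/= JD IH.
by rewrite !big_ord0 -(scale0r 0) JZ mul0r.
Qed.

(** Write [f s = f t + (s - t) g s]. By orthogonality to [L_0 = 1] the constant part contributes
    only for [n = 0]. *)
Let coef_diff n (c : X) :
  bochner_integral mu D (fun s => ell n alpha s *: f s) c ->
  phi c = (lagnorm n alpha)^-1 *
    (J (lagp n alpha * ('X - t%:P)) + (n == 0%N)%:R * lagnorm n alpha * phi (f t)).
Proof.
move=> bc; have [pn pD pZ] := dphi.
rewrite (bochner_integral_dual dphi (@cont_pos_ell n) (integrable_ell n) bc).
have h0 := lagnorm_gt0 n a1.
have iL := integrable_weight a1 (pgrow_horner (lagp n alpha)).
have iphi : mu.-integrable D (EFin \o (fun s => weight alpha s *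
    ((lagp n alpha).[s] * phi (f s)))).
  apply: (integrable_le _ (integrable_norm (integrable_weight_f (lagp n alpha)))).
    apply: cont_pos_measurable; apply: cont_posM; first exact: cont_pos_weight.
    apply: cont_posM; first by case: (pgrow_horner (lagp n alpha)).
    exact: (dual_ball_continuous dphi (derivable_cont_pos df)).
  move=> s s0 /=; rewrite !normrM normr_id ler_wpM2l ?mulr_ge0//.
  by rewrite ler_wpM2l.
have -> : (n == 0%N)%:R * lagnorm n alpha =
    Rintegral mu D (fun s => weight alpha s * (lagp n alpha).[s]).
  rewrite -(lagp_orthogonal n 0 a1); apply: eq_Rintegral => s _.
  by rewrite lagp0 hornerC mulr1.
have -> : J (lagp n alpha * ('X - t%:P)) +
    Rintegral mu D (fun s => weight alpha s * (lagp n alpha).[s]) * phi (f t) =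
    Rintegral mu D (fun s => weight alpha s * ((lagp n alpha).[s] * phi (f s))).
  rewrite [X in _ + X]mulrC -RintegralZl// -RintegralD//; last exact: integrableRZ.
  apply: eq_Rintegral => s _; rewrite hornerM hornerXsubC.
  have e : (s - t) * phi (g s) = phi (f s) - phi (f t).
    by rewrite -pZ diffqE dual_ballB.
  have -> : (lagp n alpha).[s] * (s - t) * phi (g s) =
     (lagp n alpha).[s] * ((s - t) * phi (g s)) by rewrite mulrA.
  by rewrite e; ring.
rewrite -RintegralZl//; apply: eq_Rintegral => s _.
by rewrite /= pZ ellE; ring.
Qed.

(** The constant part of the coefficient of index 0 cancels [f t]. What remains is [J] of [X - t]
    times the reproducing kernel; in the Christoffel-Darboux formula the factor [s] turns
    [weight alpha] into [weight (alpha + 1)]. *)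
Lemma dual_partial_sum (c : nat -> X) K :
  (forall n, bochner_integral mu D (fun s => ell n alpha s *: f s) (c n)) ->
  phi (\sum_(n < K.+1) laguerre n alpha t *: c n - f t) =
  (lagnorm K alpha)^-1 * ((lagp K alpha).[t] *
     Rintegral mu D (fun s => weight (alpha + 1) s *
       ((lagp K (alpha + 1)).[s] * phi (diffq f t s))) -
   t * (lagp K (alpha + 1)).[t] *
     Rintegral mu D (fun s => weight alpha s *
       ((lagp K alpha).[s] * phi (diffq f t s)))).
Proof.
move=> bc; have [pn pD pZ] := dphi.
rewrite dual_ballB// (big_morph phi pD (dual_ball0 dphi)).
under eq_bigr => n _ do rewrite pZ -horner_lagp (coef_diff (bc n)) mulrA mulrDr.
rewrite big_split/= [X in _ + X - _](_ : _ = phi (f t)); last first.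
  rewrite big_ord_recl/= big1 ?addr0; last by move=> i _; rewrite !mul0r mulr0.
  rewrite lagp0 hornerC !mul1r mulrA mulVf ?mul1r// gt_eqF//; exact: lagnorm_gt0.
rewrite addrK.
pose Q (n : nat) := ((lagp n alpha).[t] / lagnorm n alpha) *:
    (lagp n alpha * ('X - t%:P)).
transitivity (J (\sum_(n < K.+1) Q n)).
  by rewrite Jsum; apply: eq_bigr => n _; rewrite /Q JZ.
have -> : Rintegral mu D (fun s => weight (alpha + 1) s *
       ((lagp K (alpha + 1)).[s] * phi (diffq f t s))) = J ('X * lagp K (alpha + 1)).
  apply: eq_Rintegral => s; rewrite inE in_half_line => s0.
  by rewrite weightS// hornerM hornerX; ring.
rewrite -/(J (lagp K alpha)) -!JZ -mulN1r -JZ -JD -JZ.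
apply: eq_Rintegral => s _; congr (_ * (_ * _)).
have h0 := lagnorm_gt0 K a1.
rewrite hornerZ hornerD !hornerZ hornerM hornerX horner_sum.
transitivity (- ((t - s) * \sum_(n < K.+1) (lagp n alpha).[t] * (lagp n alpha).[s] /
    lagnorm n alpha)); last first.
  by rewrite laguerre_christoffel_darboux//; field; rewrite gt_eqF.
rewrite -mulNr opprB mulr_sumr; apply: eq_bigr => n _.
by rewrite /Q hornerZ hornerM hornerXsubC; ring.
Qed.

End with_functional.

Lemma laguerre_expansion_cvg (c : nat -> X) :
  (forall n, bochner_integral mu D (fun s => ell n alpha s *: f s) (c n)) ->
  (\sum_(n < N) laguerre n alpha t *: c n) @[N --> \oo] --> f t.
Proof.
move=> bc; have a2 : -1 < alpha + 1 by apply: (lt_trans a1); rewrite ltrDl.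
have [C1 C10 hC1] := laguerre_pointwise_bound a1 t0.
have [C2 C20 hC2] := laguerre_pointwise_bound a2 t0.
pose B : R := Num.sqrt (2 + `|alpha|) * (Num.sqrt C1 + t * Num.sqrt C2).
have B0 : 0 <= B.
  apply: mulr_ge0; first exact: sqrtr_ge0.
  by apply: addr_ge0; [|apply: mulr_ge0; first exact: ltW]; exact: sqrtr_ge0.
have B1 : 0 < B + 1 by exact: ltr_wpDl.
apply/cvgrPdist_lt => e e0.
(* [B + 1] serves as denominator because [B] is only known to be nonnegative. *)
pose e' : R := e / (B + 1).
have e'0 : 0 < e' by exact: divr_gt0.
have e'B : e' * B < e.
  by rewrite /e' mulrAC ltr_pdivrMr// ltr_pM2l// ltrDl.
have [ig1 ig2] := ig0.
have [N1 hN1] := laguerre_riemann_lebesgue a1 cg e'0 ig1.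
have [N2 hN2] := laguerre_riemann_lebesgue a2 cg e'0 ig2.
(* The sum over [n < K.+1] has last index [K], hence the successor. *)
exists (maxn 2 (maxn N1 N2)).+1 => // -[|K]//=.
rewrite ltnS !geq_max => /and3P[K2 KN1 KN2].
set v := \sum_(n < K.+1) _; rewrite distrC.
have [phi [p1 p2 p3 pE]] := norming_functional (v - f t).
have dphi : dual_ball phi by split.
have sqrt_bnd (C x y : R) : 0 <= C -> x ^+ 2 <= C * y -> `|x| <= Num.sqrt C * Num.sqrt y.
  by move=> C0 xy; rewrite -sqrtrM// -sqrtr_sqr ler_wsqrtr.
have b1 := sqrt_bnd _ _ _ C10 (hC1 K K2); have b2 := sqrt_bnd _ _ _ C20 (hC2 K K2).
have r1 := hN1 K KN1 phi dphi; have r2 := hN2 K KN2 phi dphi.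
have qq := lagrate_product a1 (ltnW K2).
rewrite -pE (dual_partial_sum dphi K bc); apply: le_lt_trans e'B.
exact: (error_combination (lagnorm_gt0 K a1) (ltW t0) (ltW e'0) (sqrtr_ge0 _)
  (sqrtr_ge0 _) qq b1 b2 r1 r2).
Qed.

End laguerre_expansion.

Unset Implicit Arguments.

Theorem theorem3p4 (R : realType) (X : completeNormedModType R) (alpha : R)
  (f : R -> X) :
  -1 < alpha ->
  (forall t : R, 0 < t -> derivable f t 1) ->
  (\int[lebesgue_measure]_(t in `]0%R, +oo[)
      (expR (- t) * t `^ alpha * `| f t | ^+ 2)%:E < +oo)%E ->
  (forall n : nat, exists c : X,
      bochner_integral lebesgue_measure `]0%R, +oo[ (fun t => ell n alpha t *: f t) c) /\
  (forall c : nat -> X,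
      (forall n, bochner_integral lebesgue_measure `]0%R, +oo[
                   (fun t => ell n alpha t *: f t) (c n)) ->
      forall t : R, 0 < t ->
        (\sum_(n < N) laguerre n alpha t *: c n) @[N --> \oo] --> f t).
Proof.
move=> a1 df fin.
have iF : lebesgue_measure.-integrable [set` `]0%R, +oo[ : interval R]
    (EFin \o (fun s => weight alpha s * `|f s| ^+ 2)).
  apply: integrable_pos_fin.
  - apply: cont_pos_measurable; apply: cont_posM; first exact: cont_pos_weight.
    by apply: cont_posM; exact: cont_pos_norm (derivable_cont_pos df).
  - by move=> s _; rewrite mulr_ge0 ?weight_ge0 ?sqr_ge0.
  - apply: le_lt_trans fin; rewrite le_eqVlt; apply/orP; left; apply/eqP.
    by apply: eq_integral => s _; rewrite /weight [s `^ _ * _]mulrC.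
split=> [n|c bc t t0].
  by apply: bochner_integral_exists; [exact: cont_pos_ell|exact: integrable_ell].
exact: (laguerre_expansion_cvg a1 df iF t0 bc).
Qed.
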